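(* Let $R$ be a ring. Then the following are equivalent: (1) $R$ is right $\mathcal F_1^{\mathrm{fp}}$-coherent; (2) any direct product of $\mathcal F_1^{\mathrm{fp}}$-flat left $R$-modules is $\mathcal F_1^{\mathrm{fp}}$-flat; (3) any direct product of flat left $R$-modules is $\mathcal F_1^{\mathrm{fp}}$-flat; (4) any direct product of copies of the left $R$-module $R$ is $\mathcal F_1^{\mathrm{fp}}$-flat; (5) any inverse limit of $\mathcal F_1^{\mathrm{fp}}$-flat left $R$-modules is $\mathcal F_1^{\mathrm{fp}}$-flat; (6) any module $M\in\mathcal F_1^{\mathrm{fp}}$ is $2$-presented; (7) $\mathcal F_1^{\mathrm{fp}}=\mathcal P_1^{\mathrm{fp}}$; (8) a left $R$-module $M$ is $\mathcal F_1^{\mathrm{fp}}$-flat if and only if $M^{++}$ is $\mathcal F_1^{\mathrm{fp}}$-flat; (9) any torsionless left $R$-module is $\mathcal F_1^{\mathrm{fp}}$-flat; (10) $\mathcal F_1^{\mathrm{fp}}\mathcal F(R)=\mathcal P_1\mathcal F(R)$; (11) $\varinjlim\mathcal F_1^{\mathrm{fp}}=\varinjlim\mathcal P_1$; (12) $\widehat{\mathcal P_1}=\widehat{\mathcal F_1^{\mathrm{fp}}}$.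
   Context: $R$ is an associative ring with unit and modules are unital. $\mathcal F_1$ (resp. $\mathcal P_1$) is the class of right $R$-modules of flat (resp. projective) dimension at most $1$; $\mathcal F_1^{\mathrm{fp}}$ (resp. $\mathcal P_1^{\mathrm{fp}}$) is the subclass of finitely presented modules in $\mathcal F_1$ (resp. $\mathcal P_1$). A left $R$-module $M$ is $\mathcal F_1^{\mathrm{fp}}$-flat (resp. $\mathcal P_1$-flat) if $\mathrm{Tor}_1^R(H,M)=0$ for every $H\in\mathcal F_1^{\mathrm{fp}}$ (resp. $H\in\mathcal P_1$); the class of all such left modules is denoted $\mathcal F_1^{\mathrm{fp}}\mathcal F(R)$ (resp. $\mathcal P_1\mathcal F(R)$). $R$ is right $\mathcal F_1^{\mathrm{fp}}$-coherent if every finitely generated flat right submodule of a free right module is finitely presented (and thus projective). A module $M$ is $2$-presented if there is an exact sequence $L_2\to L_1\to L_0\to M\to 0$ with each $L_i$ finitely generated free. $M^+=\mathrm{Hom}_{\mathbb Z}(M,\mathbb Q/\mathbb Z)$ is the character module, and $M^{++}=(M^+)^+$. A left module is torsionless if it is isomorphic to a submodule of a direct product of copies of $R$. Inverse limits are taken over inverse systems indexed by partially ordered sets. For a class $\mathcal C$ of right modules, $\varinjlim\mathcal C$ is the class of all modules that are direct limits of direct systems (over directed sets) of modules in $\mathcal C$; $\mathcal C^\top$ is the class of left modules $M$ with $\mathrm{Tor}_1^R(C,M)=0$ for all $C\in\mathcal C$; for a class $\mathcal D$ of left modules, ${}^\top\mathcal D$ is the class of right modules $N$ with $\mathrm{Tor}_1^R(N,D)=0$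 for all $D\in\mathcal D$; and $\widehat{\mathcal C}={}^\top(\mathcal C^\top)$. *)

(* Defs.v *)
From HB Require Import structures.
From mathcomp Require Import all_boot all_order all_algebra.
From mathcomp Require Import mathcomp_extra boolp classical_sets functions.
From mathcomp Require Import cardinality fsbigop.

Set Implicit Arguments.
Unset Strict Implicit.
Unset Printing Implicit Defensive.

Import Order.TTheory GRing.Theory Num.Theory.
Local Open Scope classical_set_scope.
Local Open Scope ring_scope.

(* Left R-modules are lmodType R and right R-modules are left modules over the
   converse ring R^c. Rings are pzRingType, so the zero ring is not excluded. *)
Notation rmodType R := (lmodType (R^c)%type) (only parsing).

Definition surj (A B : Type) (f : A -> B) := forall y, exists x, f x = y.

Definition exact_at (A B : Type) (C : zmodType) (f : A -> B) (g : B -> C) :=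
  forall y, g y = 0 <-> exists x, f x = y.

Section FreeModule.
Variables (S : pzRingType) (K : choiceType).

Definition fin_supp : {pred K -> S^o} :=
  fun x => `[< finite_set [set k | x k != 0] >].

Lemma fin_supp_submod : submod_closed fin_supp.
Proof.
split=> [|a x y /asboolP xfin /asboolP yfin]; apply/asboolP.
  by apply: (sub_finite_set _ (finite_set0 K)) => k /=; rewrite eqxx.
apply: (sub_finite_set _ (_ : finite_set
  ([set k | x k != 0] `|` [set k | y k != 0]))); last by rewrite finite_setU.
move=> k /=; apply: contraNP => /not_orP[/negP/negPn/eqP xk0 /negP/negPn/eqP yk0].
by rewrite addrfctE scalrfctE xk0 yk0 scaler0 addr0.
Qed.

HB.instance Definition _ := GRing.isSubmodClosed.Build S (K -> S^o) fin_supp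
  fin_supp_submod.

Record freemod := FreeMod { fcoef :> K -> S^o; fcoefP : fcoef \in fin_supp }.

HB.instance Definition _ := [isSub for fcoef].
HB.instance Definition _ := [Choice of freemod by <:].
HB.instance Definition _ := [SubChoice_isSubLmodule of freemod by <:].

Fact fbasis_subproof (k : K) : (fun j => (j == k)%:R : S^o) \in fin_supp.
Proof.
apply/asboolP; apply: (sub_finite_set _ (finite_set1 k)) => j /=.
by case: (j =P k) => // _; rewrite eqxx.
Qed.

Definition fbasis (k : K) : freemod := FreeMod (fbasis_subproof k).

Variables (V : lmodType S) (h : K -> V).

Definition fext (x : freemod) : V :=
  (\sum_(k \in [set: K]) (fcoef x k : S) *: h k)%R.

Lemma fextE (s : seq K) (x : freemod) : uniq s ->
  (forall k, fcoef x k != 0 -> k \in s) ->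
  fext x = (\sum_(k <- s) (fcoef x k : S) *: h k)%R.
Proof.
move=> s_uniq xs; rewrite /fext (fsbigE s) //=.
  by under eq_bigl do rewrite in_setT.
by move=> k _ ks; case: (eqVneq (fcoef x k) 0) => [->|/xs]; rewrite ?scale0r ?(negPf ks).
Qed.

Lemma fext_linear : linear fext.
Proof.
move=> a x y.
have [s [s_uniq xs ys]] : exists s : seq K, [/\ uniq s,
    forall k, fcoef x k != 0 -> k \in s & forall k, fcoef y k != 0 -> k \in s].
  have /asboolP/finite_seqP[sx sxE] := fcoefP x.
  have /asboolP/finite_seqP[sy syE] := fcoefP y.
  exists (undup (sx ++ sy)); split; first exact: undup_uniq.
    move=> k xk; rewrite mem_undup mem_cat; apply/orP; left.
    by have : [set k | fcoef x k != 0] k by []; rewrite sxE.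
  move=> k yk; rewrite mem_undup mem_cat; apply/orP; right.
  by have : [set k | fcoef y k != 0] k by []; rewrite syE.
have E k : fcoef (a *: x + y) k = a * (fcoef x k : S) + fcoef y k by [].
rewrite !(@fextE s) //; last first.
  move=> k; case: (boolP (k \in s)) => // ks.
  have -> : fcoef (a *: x + y) k = 0; last by rewrite eqxx.
  rewrite E.
  case: (eqVneq (fcoef x k) 0) => [->|/xs]; last by rewrite (negPf ks).
  case: (eqVneq (fcoef y k) 0) => [->|/ys]; last by rewrite (negPf ks).
  by rewrite mulr0 addr0.
rewrite scaler_sumr -big_split /=; apply: eq_bigr => k _.
by rewrite scalerA -scalerDl.
Qed.

HB.instance Definition _ := GRing.isLinear.Build S freemod V _ fext fext_linear.

Lemma fext_fbasis k : fext (fbasis k) = h k.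
Proof.
rewrite (@fextE [:: k]) //= => [|j]; first by rewrite big_seq1 eqxx scale1r.
by rewrite inE; case: (j =P k) => // _; rewrite eqxx.
Qed.

End FreeModule.

Section KernelModule.
Variables (S : pzRingType) (U V : lmodType S) (f : {linear U -> V}).

Definition in_ker : {pred U} := fun x => f x == 0.

Lemma in_ker_submod : submod_closed in_ker.
Proof.
split=> [|a x y]; rewrite !unfold_in ?linear0 //.
by move=> /eqP fx /eqP fy; rewrite linearP fx fy scaler0 addr0.
Qed.

HB.instance Definition _ := GRing.isSubmodClosed.Build S U in_ker in_ker_submod.

Record kermod := Ker { kval :> U; kvalP : kval \in in_ker }.

HB.instance Definition _ := [isSub for kval].
HB.instance Definition _ := [Choice of kermod by <:].
HB.instance Definition _ := [SubChoice_isSubLmodule of kermod by <:].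

Lemma kval_linear : linear kval.
Proof. by []. Qed.

HB.instance Definition _ := GRing.isLinear.Build S kermod U _ kval kval_linear.

End KernelModule.

(* For a complex, boundaries are cycles, so that homology f g is ker g / im f. *)
Section Homology.
Variables (A B C : zmodType) (f : {additive A -> B}) (g : {additive B -> C}).

Definition in_cycles : {pred B} := fun x => g x == 0.

Lemma in_cycles_zmod : zmod_closed in_cycles.
Proof.
split=> [|x y]; rewrite !unfold_in ?raddf0 //.
by move=> /eqP gx /eqP gy; rewrite raddfB gx gy subr0.
Qed.

HB.instance Definition _ := GRing.isZmodClosed.Build B in_cycles in_cycles_zmod.

Record cycles := Cycle { cval :> B; cvalP : cval \in in_cycles }.

HB.instance Definition _ := [isSub for cval].
HB.instance Definition _ := [Choice of cycles by <:].
HB.instance Definition _ := [SubChoice_isSubZmodule of cycles by <:].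

Definition boundary : {pred cycles} := fun z => `[< exists a, f a = cval z >].

Lemma boundary_zmod : zmod_closed boundary.
Proof.
split=> [|x y /asboolP[a fa] /asboolP[b fb]]; apply/asboolP.
  by exists 0; rewrite raddf0.
by exists (a - b); rewrite raddfB fa fb.
Qed.

HB.instance Definition _ := GRing.isZmodClosed.Build cycles boundary boundary_zmod.

Definition homology : zmodType := Quotient.quot boundary.

End Homology.

(* The canonical free resolution of H: with K_0 = H and K_{n+1} the kernel of the
   augmentation S^(K_n) -> K_n, its n-th term is S^(K_n) and its differentials
   are the composites S^(K_{n+1}) -> K_{n+1} -> S^(K_n). *)
Section CanonicalResolution.
Variables (S : pzRingType).

Definition aug (H : lmodType S) : {linear freemod S H -> H} := fext (@idfun H).

Fixpoint syzygy (H : lmodType S) (n : nat) : lmodType S :=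
  if n is n'.+1 then kermod (aug (syzygy H n')) else H.

Definition free_res (H : lmodType S) (n : nat) : lmodType S := freemod S (syzygy H n).

Definition free_res_diff (H : lmodType S) (n : nat) :
    {linear free_res H n.+1 -> free_res H n} :=
  @kval S _ _ (aug (syzygy H n)) \o aug (syzygy H n.+1).

End CanonicalResolution.

(* N (x) M is the free abelian group on N * M modulo the subgroup tens_rel
   generated by the bilinearity relations and (n r) (x) m = n (x) (r m). *)
Section Tensor.
Variables (R : pzRingType) (N : rmodType R) (M : lmodType R).

Local Notation gen n m := (fbasis int ((n, m) : (N * M)%type)).

Inductive tens_rel : freemod int (N * M)%type -> Prop :=
| Tens_rel0 : tens_rel 0
| Tens_relB x y : tens_rel x -> tens_rel y -> tens_rel (x - y)
| Tens_relDl n n' m : tens_rel (gen (n + n') m - gen n m - gen n' m)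
| Tens_relDr n m m' : tens_rel (gen n (m + m') - gen n m - gen n m')
| Tens_relZ n (r : R) m : tens_rel (gen ((r : R^c) *: n) m - gen n (r *: m)).

Definition in_tens_rel : {pred freemod int (N * M)%type} :=
  fun x => `[< tens_rel x >].

Lemma in_tens_rel_zmod : zmod_closed in_tens_rel.
Proof.
split=> [|x y /asboolP rx /asboolP ry]; apply/asboolP.
  exact: Tens_rel0.
exact: Tens_relB.
Qed.

HB.instance Definition _ :=
  GRing.isZmodClosed.Build (freemod int (N * M)%type) in_tens_rel in_tens_rel_zmod.

Definition tens : zmodType := Quotient.quot in_tens_rel.

Definition tpure (n : N) (m : M) : tens := \pi_tens%qT (gen n m).

End Tensor.

Section TensorMap.
Variables (R : pzRingType) (N N' : rmodType R) (M M' : lmodType R).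
Variables (f : {linear N -> N'}) (g : {linear M -> M'}).

Let h (p : N * M) : zmodule (tens N' M') := tpure (f p.1) (g p.2).

(* This does not depend on the chosen representative of t: see tmap_pi. *)
Definition tmap (t : tens N M) : tens N' M' := fext h (repr t).

End TensorMap.

Section TensorTheory.
Variables (R : pzRingType) (N : rmodType R) (M : lmodType R).

Lemma tpi_eq0 (x : freemod int (N * M)%type) :
  tens_rel x -> \pi_(tens N M)%qT x = 0.
Proof.
move=> rx; rewrite -(raddf0 (\pi_(tens N M)%qT)); apply/eqP.
by rewrite -Quotient.idealrBE subr0; apply/asboolP.
Qed.

Lemma tpureDl (n n' : N) (m : M) : tpure (n + n') m = tpure n m + tpure n' m.
Proof.
have /tpi_eq0 := Tens_relDl n n' m.
by rewrite !raddfB /= => /eqP; rewrite -addrA -opprD subr_eq0 => /eqP.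
Qed.

Lemma tpureDr (n : N) (m m' : M) : tpure n (m + m') = tpure n m + tpure n m'.
Proof.
have /tpi_eq0 := Tens_relDr n m m'.
by rewrite !raddfB /= => /eqP; rewrite -addrA -opprD subr_eq0 => /eqP.
Qed.

Lemma tpureZ (n : N) (r : R) (m : M) :
  tpure ((r : R^c) *: n) m = tpure n (r *: m).
Proof.
have /tpi_eq0 := Tens_relZ n r m.
by rewrite !raddfB /= => /eqP; rewrite subr_eq0 => /eqP.
Qed.

End TensorTheory.

Section TensorMapTheory.
Variables (R : pzRingType) (N N' : rmodType R) (M M' : lmodType R).
Variables (f : {linear N -> N'}) (g : {linear M -> M'}).

Let h (p : N * M) : zmodule (tens N' M') := tpure (f p.1) (g p.2).

Let hB (x y : freemod int (N * M)%type) : fext h (x - y) = fext h x - fext h y.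
Proof. exact: raddfB. Qed.

Lemma fext_tens_rel x : tens_rel x -> fext h x = 0.
Proof.
elim=> [|y z _ hy _ hz|n n' m|n m m'|n r m]; first exact: raddf0.
- by rewrite hB hy hz subr0.
- rewrite !hB !fext_fbasis /h /= raddfD tpureDl.
  by rewrite -addrA -opprD; apply: subrr.
- rewrite !hB !fext_fbasis /h /= raddfD tpureDr.
  by rewrite -addrA -opprD; apply: subrr.
- rewrite hB !fext_fbasis /h /= !linearZ tpureZ; exact: subrr.
Qed.

Lemma tmap_pi x : tmap f g (\pi_(tens N M)%qT x) = fext h x.
Proof.
apply/eqP; rewrite -subr_eq0 /tmap -[X in X == _]hB; apply/eqP/fext_tens_rel.
have : (repr (\pi_(tens N M)%qT x) == x %[mod tens N M])%qT by rewrite reprK.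
by rewrite -Quotient.idealrBE => /asboolP.
Qed.

Lemma tmap_is_zmod_morphism : zmod_morphism (tmap f g).
Proof.
move=> s t; rewrite -[s]reprK -[t]reprK -raddfB !tmap_pi raddfB.
by [].
Qed.

HB.instance Definition _ :=
  GRing.isZmodMorphism.Build (tens N M) (tens N' M') (tmap f g)
    tmap_is_zmod_morphism.

Lemma tmap_tpure n m : tmap f g (tpure n m) = tpure (f n) (g m).
Proof. by rewrite tmap_pi fext_fbasis. Qed.

End TensorMapTheory.

(* Tor_n(H, M) is the n-th homology of P (x) M for the canonical free resolution P
   of the right module H. *)
Section Tor.
Variables (R : pzRingType) (H : rmodType R) (M : lmodType R).

Definition tor_diff (n : nat) :
    {additive tens (free_res H n.+1) M -> tens (free_res H n) M} :=
  tmap (free_res_diff H n) (@idfun M).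

Definition Tor (n : nat) : zmodType :=
  if n is n'.+1 then homology (tor_diff n'.+1) (tor_diff n')
  else homology (tor_diff 0)
         (\0 : {additive tens (free_res H 0) M -> tens (free_res H 0) M}).

Definition tor_vanishes (n : nat) := forall x : Tor n, x = 0.

End Tor.

Definition intQ : {pred rat} := fun q => q \is a Num.int.

Lemma intQ_zmod : zmod_closed intQ.
Proof. split=> [|x y]; rewrite !unfold_in; [exact: rpred0 | exact: rpredB]. Qed.

HB.instance Definition _ := GRing.isZmodClosed.Build rat intQ intQ_zmod.

Definition QmodZ : zmodType := Quotient.quot intQ.

Section Character.
Variable A : zmodType.

Definition is_char : {pred A -> QmodZ} := fun u => `[< zmod_morphism u >].

Lemma is_char_zmod : zmod_closed is_char.
Proof.
split=> [|u v /asboolP hu /asboolP hv]; apply/asboolP => x y.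
  by rewrite subr0.
by rewrite /= !fctE hu hv !opprD !opprK addrACA.
Qed.

HB.instance Definition _ := GRing.isZmodClosed.Build (A -> QmodZ) is_char is_char_zmod.

Record charmod := Char { char_fun :> A -> QmodZ; charP : char_fun \in is_char }.

HB.instance Definition _ := [isSub for char_fun].
HB.instance Definition _ := [Choice of charmod by <:].
HB.instance Definition _ := [SubChoice_isSubZmodule of charmod by <:].

Lemma charB (u : charmod) x y : u (x - y) = u x - u y.
Proof. by have /asboolP := charP u; apply. Qed.

Lemma charD (u : charmod) x y : u (x + y) = u x + u y.
Proof.
have u0 : u 0 = 0 by rewrite -(subrr 0) charB subrr.
by rewrite -[y in LHS]opprK charB -[- y]sub0r charB u0 sub0r opprK.
Qed.

End Character.

(* The character module of a left (resp. right) module is a right (resp. left)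
   module: (u r)(m) = u (r m), resp. (r u)(n) = u (n r). *)
Section LeftCharacter.
Variables (R : pzRingType) (M : lmodType R).

Definition lchar := charmod M.

HB.instance Definition _ := GRing.Zmodule.on lchar.

Fact lchar_scale_subproof (r : R^c) (u : lchar) :
  (fun m : M => u ((r : R) *: m)) \in @is_char M.
Proof.
by apply/asboolP => x y; rewrite scalerBr charB.
Qed.

Definition lchar_scale r u : lchar := Char (lchar_scale_subproof r u).

Lemma lchar_scaleA r s u : lchar_scale r (lchar_scale s u) = lchar_scale (r * s) u.
Proof. by apply/val_inj/funext => m /=; rewrite scalerA. Qed.

Lemma lchar_scale1 : left_id 1 lchar_scale.
Proof. by move=> u; apply/val_inj/funext => m /=; rewrite scale1r. Qed.

Lemma lchar_scaleDr : right_distributive lchar_scale +%R.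
Proof. by move=> r u v; apply/val_inj/funext. Qed.

Lemma lchar_scaleDl u : {morph lchar_scale^~ u : r s / r + s}.
Proof. by move=> r s; apply/val_inj/funext => m /=; rewrite scalerDl charD. Qed.

HB.instance Definition _ := GRing.Zmodule_isLmodule.Build R^c lchar
  lchar_scaleA lchar_scale1 lchar_scaleDr lchar_scaleDl.

End LeftCharacter.

Section RightCharacter.
Variables (R : pzRingType) (N : rmodType R).

Definition rchar := charmod N.

HB.instance Definition _ := GRing.Zmodule.on rchar.

Fact rchar_scale_subproof (r : R) (u : rchar) :
  (fun n : N => u ((r : R^c) *: n)) \in @is_char N.
Proof. by apply/asboolP => x y; rewrite scalerBr charB. Qed.

Definition rchar_scale r u : rchar := Char (rchar_scale_subproof r u).

Lemma rchar_scaleA r s u : rchar_scale r (rchar_scale s u) = rchar_scale (r * s) u.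
Proof. by apply/val_inj/funext => m /=; rewrite scalerA. Qed.

Lemma rchar_scale1 : left_id 1 rchar_scale.
Proof. by move=> u; apply/val_inj/funext => m /=; rewrite scale1r. Qed.

Lemma rchar_scaleDr : right_distributive rchar_scale +%R.
Proof. by move=> r u v; apply/val_inj/funext. Qed.

Lemma rchar_scaleDl u : {morph rchar_scale^~ u : r s / r + s}.
Proof. by move=> r s; apply/val_inj/funext => m /=; rewrite scalerDl charD. Qed.

HB.instance Definition _ := GRing.Zmodule_isLmodule.Build R rchar
  rchar_scaleA rchar_scale1 rchar_scaleDr rchar_scaleDl.

End RightCharacter.

Section DirectProduct.
Variables (R : pzRingType) (I : Type) (M : I -> lmodType R).

Definition dprod := forall i, M i.

HB.instance Definition _ := gen_eqMixin dprod.
HB.instance Definition _ := gen_choiceMixin dprod.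

Let dzero : dprod := fun=> 0.
Let dopp (x : dprod) : dprod := fun i => - x i.
Let dadd (x y : dprod) : dprod := fun i => x i + y i.
Let dscale (r : R) (x : dprod) : dprod := fun i => r *: x i.

Lemma dprod_addA : associative dadd.
Proof. by move=> x y z; apply: functional_extensionality_dep => i; exact: addrA. Qed.

Lemma dprod_addC : commutative dadd.
Proof. by move=> x y; apply: functional_extensionality_dep => i; exact: addrC. Qed.

Lemma dprod_add0 : left_id dzero dadd.
Proof. by move=> x; apply: functional_extensionality_dep => i; exact: add0r. Qed.

Lemma dprod_addN : left_inverse dzero dopp dadd.
Proof. by move=> x; apply: functional_extensionality_dep => i; exact: addNr. Qed.

HB.instance Definition _ :=
  GRing.isZmodule.Build dprod dprod_addA dprod_addC dprod_add0 dprod_addN.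

Lemma dprod_scaleA r s x : dscale r (dscale s x) = dscale (r * s) x.
Proof. by apply: functional_extensionality_dep => i; exact: scalerA. Qed.

Lemma dprod_scale1 : left_id 1 dscale.
Proof. by move=> x; apply: functional_extensionality_dep => i; exact: scale1r. Qed.

Lemma dprod_scaleDr : right_distributive dscale +%R.
Proof. by move=> r x y; apply: functional_extensionality_dep => i; exact: scalerDr. Qed.

Lemma dprod_scaleDl x : {morph dscale^~ x : r s / r + s}.
Proof. by move=> r s; apply: functional_extensionality_dep => i; exact: scalerDl. Qed.

HB.instance Definition _ := GRing.Zmodule_isLmodule.Build R dprod
  dprod_scaleA dprod_scale1 dprod_scaleDr dprod_scaleDl.

End DirectProduct.

Section Limits.
Variables (S : pzRingType) (d : Order.disp_t) (I : porderType d).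

Record direct_system := DirectSystem {
  ds_obj :> I -> lmodType S;
  ds_map : forall i j, (i <= j)%O -> {linear ds_obj i -> ds_obj j};
  ds_map_id : forall i (ii : (i <= i)%O) x, ds_map ii x = x;
  ds_map_comp : forall i j k (ij : (i <= j)%O) (jk : (j <= k)%O)
    (ik : (i <= k)%O) x, ds_map jk (ds_map ij x) = ds_map ik x }.

Record inverse_system := InverseSystem {
  is_obj :> I -> lmodType S;
  is_map : forall i j, (i <= j)%O -> {linear is_obj j -> is_obj i};
  is_map_id : forall i (ii : (i <= i)%O) x, is_map ii x = x;
  is_map_comp : forall i j k (ij : (i <= j)%O) (jk : (j <= k)%O)
    (ik : (i <= k)%O) x, is_map ij (is_map jk x) = is_map ik x }.

Definition directed_poset :=
  (exists i : I, True) /\ forall i j : I, exists k, (i <= k)%O /\ (j <= k)%O.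

Definition is_cocone (D : direct_system) (L : lmodType S)
    (u : forall i, {linear D i -> L}) :=
  forall i j (ij : (i <= j)%O) x, u j (ds_map D ij x) = u i x.

Definition is_direct_limit (D : direct_system) (L : lmodType S)
    (u : forall i, {linear D i -> L}) :=
  is_cocone u /\
  forall (X : lmodType S) (v : forall i, {linear D i -> X}), is_cocone v ->
    exists2 w : {linear L -> X}, (forall i x, w (u i x) = v i x) &
      forall w' : {linear L -> X}, (forall i x, w' (u i x) = v i x) -> w' =1 w.

Definition is_cone (D : inverse_system) (L : lmodType S)
    (u : forall i, {linear L -> D i}) :=
  forall i j (ij : (i <= j)%O) x, is_map D ij (u j x) = u i x.

Definition is_inverse_limit (D : inverse_system) (L : lmodType S)
    (u : forall i, {linear L -> D i}) :=
  is_cone u /\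
  forall (X : lmodType S) (v : forall i, {linear X -> D i}), is_cone v ->
    exists2 w : {linear X -> L}, (forall i x, u i (w x) = v i x) &
      forall w' : {linear X -> L}, (forall i x, u i (w' x) = v i x) -> w' =1 w.

End Limits.

Definition dlim (S : pzRingType) (C : lmodType S -> Prop) (M : lmodType S) :=
  exists (d : Order.disp_t) (I : porderType d) (D : direct_system S I)
    (u : forall i, {linear D i -> M}),
    [/\ directed_poset I, forall i, C (D i) & is_direct_limit u].

Section ModuleClasses.
Variable S : pzRingType.
Implicit Type M : lmodType S.

Definition short_exact (A B M : lmodType S) (f : {linear A -> B})
    (g : {linear B -> M}) := [/\ injective f, exact_at f g & surj g].

Definition isomorphic (A B : lmodType S) :=
  exists f : {linear A -> B}, bijective f.

Definition free_module F := exists K : choiceType, isomorphic F (freemod S K).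

Definition projective P :=
  forall (A B : lmodType S) (g : {linear A -> B}) (f : {linear P -> B}),
    surj g -> exists f' : {linear P -> A}, forall x, g (f' x) = f x.

Definition dim_le1 (C : lmodType S -> Prop) M :=
  exists (X1 X0 : lmodType S) (f : {linear X1 -> X0}) (g : {linear X0 -> M}),
    [/\ C X1, C X0 & short_exact f g].

(* 'rV[S]_n is the free module S^n, over S = R^c as well as over S = R. *)
Definition fin_generated M :=
  exists n (g : {linear 'rV[S]_n -> M}), surj g.

Definition fin_presented M :=
  exists n1 n0 (f : {linear 'rV[S]_n1 -> 'rV[S]_n0})
    (g : {linear 'rV[S]_n0 -> M}), exact_at f g /\ surj g.

Definition two_presented M :=
  exists n2 n1 n0 (e : {linear 'rV[S]_n2 -> 'rV[S]_n1})
    (f : {linear 'rV[S]_n1 -> 'rV[S]_n0}) (g : {linear 'rV[S]_n0 -> M}),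
    [/\ exact_at e f, exact_at f g & surj g].

Definition torsionless M :=
  exists (I : Type) (f : {linear M -> dprod (fun _ : I => S^o)}), injective f.

Definition P1 : lmodType S -> Prop := dim_le1 projective.

Definition P1fp M := fin_presented M /\ P1 M.

End ModuleClasses.

Section FlatClasses.
Variable R : pzRingType.

Definition flat_right (N : rmodType R) :=
  forall (M M' : lmodType R) (g : {linear M -> M'}),
    injective g -> injective (tmap (@idfun N) g).

Definition flat_left (M : lmodType R) :=
  forall (N N' : rmodType R) (f : {linear N -> N'}),
    injective f -> injective (tmap f (@idfun M)).

Definition F1 : rmodType R -> Prop := dim_le1 flat_right.

Definition F1fp (H : rmodType R) := fin_presented H /\ F1 H.

(* The Tor-orthogonal classes C^T of a class of right modules and ^T D of a class
   of left modules. *)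
Definition rtor (C : rmodType R -> Prop) (M : lmodType R) :=
  forall H, C H -> tor_vanishes H M 1.

Definition ltor (D : lmodType R -> Prop) (N : rmodType R) :=
  forall M, D M -> tor_vanishes N M 1.

Definition hat (C : rmodType R -> Prop) := ltor (rtor C).

Definition F1fp_flat : lmodType R -> Prop := rtor F1fp.

Definition P1_flat : lmodType R -> Prop := rtor (@P1 R^c).

Definition right_F1fp_coherent :=
  forall (F N : rmodType R) (i : {linear N -> F}),
    free_module F -> injective i -> fin_generated N -> flat_right N ->
    fin_presented N.

End FlatClasses.

(* Main.v *)
(* Let K be the kernel of a surjection from a finitely generated free module onto
   a module H in F1fp. It is finitely generated and flat, and flat finitely
   presented modules are projective, which gives (1) => (6) => (7). Conversely (4)
   makes K finitely presented.

   Every module of P1 is a filtered colimit of cokernels of injective matrices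
   f : R^m -> R^n, so M is P1-flat if and only if all the induced maps M^m -> M^n
   are injective. This condition passes to products, inverse limits, submodules
   and biduals. Since F1fp-flat modules are always P1-flat, the statement (7),
   which makes P1-flat modules F1fp-flat, implies (2)-(5), (8)-(10) and (12).

   For (8) => (4), extend the sum of finitely supported families to a character s
   of (Q/Z)^I. It embeds R^I in the bidual of the free module R^(I) through
   r |-> (u |-> s (u (r_i e_i))_i), and F1fp-flatness passes to submodules.

   (11) rests on the criterion that H lies in the limit closure of a class of
   finitely presented modules if and only if every map to H from a finitely
   presented module factors through the class. *)

From HB Require Import structures.
From mathcomp Require Import all_boot all_order all_algebra finmap.
From mathcomp Require Import boolp classical_sets functions cardinality.
Require Import Defs.

Set Implicit Arguments.
Unset Strict Implicit.
Unset Printing Implicit Defensive.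

Import Order.TTheory GRing.Theory Num.Theory.

Local Open Scope ring_scope.

(** * Linear maps and free modules *)

(** The vanishing of Tor_1(H, M) is read off any single surjection F -> H from a projective module
    with kernel K: it says that K (x) M -> F (x) M is injective, so Tor arguments become chases in
    tensor products. For H in F1 this K is flat whichever F is chosen, which takes the place of the
    vanishing of Tor_2.

    A module of P1 may be infinitely generated, and its resolution consists of projective rather
    than free modules. The passage to matrices therefore goes through [fp_factors]: a single tensor
    involves finitely many relations, so factoring maps from finitely presented modules already
    controls Tor, and an actual direct system is built only where the limit closures themselves are
    compared. That construction is applied to F1fp, whose members are finitely presented; P1 enters
    it through cokernels of injective matrices, which lie in F1fp. *)

Section LinearMaps.
Variable S : pzRingType.
Implicit Types A B D V H : lmodType S.

Definition mklin A B (f : A -> B) (fl : linear f) : {linear A -> B} :=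
  HB.pack f (GRing.isLinear.Build S A B _ f fl).

Lemma inj_ker0 (A B : zmodType) (f : {additive A -> B}) :
  (forall x, f x = 0 -> x = 0) -> injective f.
Proof.
by move=> fk x y fxy; apply/subr0_eq/fk; rewrite raddfB fxy subrr.
Qed.

Lemma ker0_inj (A B : zmodType) (f : {additive A -> B}) x :
  injective f -> f x = 0 -> x = 0.
Proof. by move=> fi fx; apply: fi; rewrite fx raddf0. Qed.

Lemma factor_surj A B D (g : {linear A -> B}) (f : {linear A -> D}) :
  surj g -> (forall x, g x = 0 -> f x = 0) ->
  exists w : {linear B -> D}, forall x, w (g x) = f x.
Proof.
move=> /choice[s sE] gf.
have fE x y : g x = g y -> f x = f y.
  by move=> gxy; apply/subr0_eq; rewrite -linearB; apply: gf; rewrite linearB gxy subrr.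
have wl : linear (f \o s).
  by move=> a x y /=; rewrite -linearP; apply: fE; rewrite linearP !sE.
by exists (mklin wl) => x; apply: fE; rewrite sE.
Qed.

Lemma factor_inj A B D (i : {linear A -> B}) (f : {linear D -> B}) :
  injective i -> (forall x, exists a, i a = f x) ->
  exists w : {linear D -> A}, forall x, i (w x) = f x.
Proof.
move=> ii /choice[w wE].
have wl : linear w by move=> a x y; apply: ii; rewrite linearP !wE linearP.
by exists (mklin wl).
Qed.

Lemma exact_ker A B (g : {linear A -> B}) : exact_at (@kval _ _ _ g) g.
Proof.
move=> y; split=> [gy|[x <-]]; last exact/eqP/kvalP.
by exists (Ker (introT eqP gy : y \in in_ker g)).
Qed.

Lemma kval_inj A B (g : {linear A -> B}) : injective (@kval _ _ _ g).
Proof. exact: val_inj. Qed.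

Lemma gkval A B (g : {linear A -> B}) (k : kermod g) : g (kval k) = 0.
Proof. exact/eqP/kvalP. Qed.

Lemma into_ker A B D (g : {linear A -> B}) (f : {linear D -> A}) :
  (forall x, g (f x) = 0) ->
  exists w : {linear D -> kermod g}, forall x, kval (w x) = f x.
Proof.
move=> gf; apply: (factor_inj (@kval_inj _ _ g)) => x.
exact/exact_ker.
Qed.

Section Quotient.
Variables (V : lmodType S) (T : {pred V}).
Hypothesis T_submod : submod_closed T.

Let quot_pred : {pred V} := T.
HB.instance Definition _ := GRing.isSubmodClosed.Build S V quot_pred T_submod.

Let Q : zmodType := Quotient.quot quot_pred.
Let pi (x : V) : Q := \pi_Q%qT x.

Let pi_eq0 x : pi x = 0 <-> x \in T.
Proof.
rewrite -(raddf0 (\pi_Q%qT)); split=> [/eqP|xT].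
  by rewrite -Quotient.idealrBE subr0.
by apply/eqP; rewrite -Quotient.idealrBE subr0.
Qed.

Let piB x y : pi (x - y) = pi x - pi y.
Proof. exact: raddfB. Qed.

Let piD x y : pi (x + y) = pi x + pi y.
Proof. exact: raddfD. Qed.

Let scaleq (a : S) (x : Q) : Q := pi (a *: repr x).

Let reprQ x : pi (repr x) = x.
Proof. exact: reprK. Qed.

Let scaleqE a x : scaleq a (pi x) = pi (a *: x).
Proof.
apply/subr0_eq; rewrite -piB -scalerBr; apply/pi_eq0.
have [T0 TP] := T_submod.
rewrite -[_ *: _]addr0; apply: TP => //; apply/pi_eq0.
by rewrite piB reprQ subrr.
Qed.

Let scaleqA a b x : scaleq a (scaleq b x) = scaleq (a * b) x.
Proof. by rewrite -[x]reprQ !scaleqE scalerA. Qed.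

Let scaleq1 : left_id 1 scaleq.
Proof. by move=> x; rewrite -[x]reprQ scaleqE scale1r. Qed.

Let scaleqDr : right_distributive scaleq +%R.
Proof.
by move=> a x y; rewrite -[x]reprQ -[y]reprQ !scaleqE -!piD !scaleqE scalerDr.
Qed.

Let scaleqDl x : {morph scaleq^~ x : a b / a + b}.
Proof. by move=> a b; rewrite -[x]reprQ !scaleqE -piD scalerDl. Qed.

Let Q' : lmodType S :=
  HB.pack Q (GRing.Zmodule_isLmodule.Build S Q scaleqA scaleq1 scaleqDr scaleqDl).

Lemma quotient_exists : exists (Q : lmodType S) (p : {linear V -> Q}),
  surj p /\ forall x, p x = 0 <-> x \in T.
Proof.
have pl : @GRing.linear_for S V Q' *:%R pi.
  by move=> a x y; rewrite piD -scaleqE.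
exists Q', (mklin pl); split=> [y|x]; last exact: pi_eq0.
by exists (repr y); apply: reprQ.
Qed.

End Quotient.

Lemma coker_exists A V (f : {linear A -> V}) :
  exists (Q : lmodType S) (p : {linear V -> Q}), exact_at f p /\ surj p.
Proof.
pose T : {pred V} := fun x => `[< exists a, f a = x >].
have Tc : submod_closed T.
  split=> [|a _ _ /asboolP[x <-] /asboolP[y <-]]; apply/asboolP.
    by exists 0; rewrite raddf0.
  by exists (a *: x + y); rewrite linearP.
have [Q [p [ps pT]]] := quotient_exists Tc.
exists Q, p; split=> // y.
by split=> [/pT/asboolP|?]; last by apply/pT/asboolP.
Qed.

Section RowModule.
Variables (n : nat) (V : lmodType S) (h : 'I_n -> V).

Definition rv_ext (v : 'rV[S]_n) : V := \sum_i v 0 i *: h i.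

Lemma rv_ext_linear : linear rv_ext.
Proof.
move=> a x y; rewrite /rv_ext scaler_sumr -big_split /=.
by apply: eq_bigr => i _; rewrite !mxE scalerDl scalerA.
Qed.

HB.instance Definition _ :=
  GRing.isLinear.Build S 'rV[S]_n V _ rv_ext rv_ext_linear.

Lemma rv_ext_delta i : rv_ext (delta_mx 0 i) = h i.
Proof.
rewrite /rv_ext (bigD1 i) //= mxE !eqxx scale1r big1 ?addr0 // => j ji.
by rewrite mxE eqxx (negPf ji) scale0r.
Qed.

End RowModule.

Lemma lin_rv_ext n V (f : {linear 'rV[S]_n -> V}) v :
  f v = \sum_i v 0 i *: f (delta_mx 0 i).
Proof.
rewrite [in LHS](matrix_sum_delta v) big_ord1 linear_sum.
by apply: eq_bigr => i _; rewrite linearZ.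
Qed.

Lemma lin_rv_eq n V (f g : {linear 'rV[S]_n -> V}) :
  (forall i, f (delta_mx 0 i) = g (delta_mx 0 i)) -> f =1 g.
Proof.
by move=> fg v; rewrite !lin_rv_ext; apply: eq_bigr => i _; rewrite fg.
Qed.

Lemma rv_projective n : projective ('rV[S]_n : lmodType S).
Proof.
move=> A B g f gs; have [s sE] := choice gs.
exists (rv_ext (fun i => s (f (delta_mx 0 i)))).
by apply: (@lin_rv_eq _ _ (g \o _)) => i /=; rewrite rv_ext_delta sE.
Qed.

Definition fcoord (K : choiceType) (k : K) (x : freemod S K) : S^o := x k.

Lemma fcoord_linear (K : choiceType) (k : K) : linear (fcoord k).
Proof. by []. Qed.

HB.instance Definition _ (K : choiceType) (k : K) :=
  GRing.isLinear.Build S (freemod S K) S^o _ (fcoord k) (@fcoord_linear K k).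

Lemma freemod_ext (K : choiceType) V (f g : {linear freemod S K -> V}) :
  (forall k, f (fbasis S k) = g (fbasis S k)) -> f =1 g.
Proof.
move=> fg x; have /asboolP/finite_seqP[s sE] := fcoefP x.
pose t := undup s.
have xE : x = \sum_(k <- t) (fcoef x k : S) *: fbasis S k.
  apply/val_inj/funext => j /=.
  transitivity (\sum_(k <- t) (fcoef x k : S) * (j == k)%:R); last first.
    by rewrite -[RHS]/(fcoord j _) linear_sum.
  case: (boolP (j \in t)) => jt.
    rewrite (bigD1_seq j) ?undup_uniq //= eqxx mulr1 big1 ?addr0 //.
    by move=> k /negPf kj; rewrite eq_sym kj mulr0.
  rewrite big_seq big1 => [|k kt].
    apply/eqP; apply: contraNT jt => xj.
    by rewrite mem_undup; move: (xj : [set k | x k != 0]%classic j); rewrite sE.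
  by have /negPf-> : j != k by [apply: contraNneq jt => ->]; rewrite mulr0.
rewrite xE !linear_sum; apply: eq_bigr => k _.
by rewrite !linearZ_LR fg.
Qed.

Lemma freemod_projective (K : choiceType) : projective (freemod S K).
Proof.
move=> A B g f gs; have [s sE] := choice gs.
exists (fext (fun k => s (f (fbasis S k)))).
by apply: (@freemod_ext _ _ (g \o _)) => k /=; rewrite fext_fbasis sE.
Qed.

Lemma aug_surj H : surj (aug H).
Proof. by move=> y; exists (fbasis S y); rewrite /= fext_fbasis. Qed.

Lemma projective_retract (P : lmodType S) : projective P ->
  exists i : {linear P -> freemod S P},  forall x, aug P (i x) = x.
Proof. by move=> /(_ _ _ (aug P) (@idfun P) (@aug_surj P)). Qed.

End LinearMaps.

(** * Tensor products *)

Section TensorProduct.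
Variable R : pzRingType.
Implicit Types (N : rmodType R) (M : lmodType R).

Lemma additive_freemodZ (K : choiceType) (A : zmodType)
    (f : {additive freemod int K -> A}) (a : int) x :
  f (a *: x) = a *: (f x : zmodule A).
Proof.
have -> : a *: x = x *~ a by rewrite -[in LHS](intz a) scaler_int.
by rewrite raddfMz.
Qed.

(** Opposites need no case of their own: -(n (x) m) = (-n) (x) m is again a pure tensor, which
    absorbs the negative coefficients. *)
Lemma tens_ind N M (P : tens N M -> Prop) :
  P 0 -> (forall n m, P (tpure n m)) -> (forall s t, P s -> P t -> P (s + t)) ->
  forall t, P t.
Proof.
move=> P0 Pp PD t.
have pureB n m : - tpure n m = tpure (- n) m :> tens N M.
  by apply/eqP; rewrite eq_sym -addr_eq0 -tpureDl addNr -(scale0r 0) tpureZ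
    scale0r -[X in X == _](addrK (tpure (0 : N) (0 : M))) -tpureDr addr0 subrr.
rewrite -[t]reprK; move: (repr t) => x.
pose pi := [the {additive freemod int (N * M)%type -> tens N M} of \pi_(tens N M)%qT].
pose pil : {linear freemod int (N * M)%type -> zmodule (tens N M)} :=
  fext (fun p : N * M => tpure p.1 p.2 : zmodule (tens N M)).
have -> : \pi_(tens N M)%qT x = pil x.
  have pl : @GRing.linear_for int (freemod int (N * M)%type) (zmodule (tens N M))
      *:%R pi.
    by move=> a y z; rewrite raddfD; congr (_ + _); exact: additive_freemodZ.
  apply: (@freemod_ext _ _ _ (mklin pl) pil) => -[n m] /=.
  by rewrite fext_fbasis.
have /asboolP/finite_seqP[s sE] := fcoefP x.
rewrite /= (@fextE _ _ _ _ (undup s)) ?undup_uniq //; last first.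
  move=> k xk; rewrite mem_undup.
  by move: (xk : [set k | x k != 0]%classic k); rewrite sE.
elim/big_ind: _ => // -[n m] _ /=.
have Pn k : P (tpure n m *+ k).
  by elim: k => [|k IH]; rewrite ?mulr0n // mulrS; apply: PD.
case: (fcoef x (n, m)) => k; first exact: Pn.
have -> : (Negz k : int) *: (tpure n m : zmodule (tens N M)) =
    (tpure (- n) m : tens N M) *+ k.+1.
  by rewrite -pureB mulNrn.
by elim: k.+1 => [|j IH]; rewrite ?mulr0n // mulrS; apply: PD.
Qed.

Lemma tens_eq N M (A : zmodType) (f g : {additive tens N M -> A}) :
  (forall n m, f (tpure n m) = g (tpure n m)) -> f =1 g.
Proof.
move=> fg; apply: tens_ind => [|//|s t fgs fgt]; first by rewrite !raddf0.
by rewrite !raddfD fgs fgt.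
Qed.

Lemma tens_sum N M (t : tens N M) : exists k (x : 'I_k -> N) (y : 'I_k -> M),
  t = \sum_i tpure (x i) (y i).
Proof.
elim/tens_ind: t => [|n m|s t [k [x [y ->]]] [l [z [w ->]]]].
- by exists 0, (fun=> 0), (fun=> 0); rewrite big_ord0.
- by exists 1, (fun=> n), (fun=> m); rewrite big_ord1.
exists (k + l)%N.
exists (fun i => match fintype.split i with inl i => x i | inr i => z i end).
exists (fun i => match fintype.split i with inl i => y i | inr i => w i end).
rewrite big_split_ord /=; congr (_ + _); apply: eq_bigr => i _.
  by rewrite (unsplitK (inl i)).
by rewrite (unsplitK (inr i)).
Qed.

Section Lift.
Variables (N : rmodType R) (M : lmodType R) (A : zmodType) (b : N -> M -> A).
Hypothesis bDl : forall n n' m, b (n + n') m = b n m + b n' m.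
Hypothesis bDr : forall n m m', b n (m + m') = b n m + b n m'.
Hypothesis bZ : forall n (r : R) m, b ((r : R^c) *: n) m = b n (r *: m).

Let h (p : N * M) : zmodule A := b p.1 p.2.

Let hB (x y : freemod int (N * M)%type) : fext h (x - y) = fext h x - fext h y.
Proof. exact: raddfB. Qed.

Let h_rel x : tens_rel x -> fext h x = 0.
Proof.
elim=> [|y z _ hy _ hz|n n' m|n m m'|n r m]; first exact: raddf0.
- by rewrite hB hy hz subr0.
- by rewrite !hB !fext_fbasis /h /= bDl -addrA -opprD; apply: subrr.
- by rewrite !hB !fext_fbasis /h /= bDr -addrA -opprD; apply: subrr.
- by rewrite hB !fext_fbasis /h /= bZ; apply: subrr.
Qed.

Let g (t : tens N M) : A := fext h (repr t).

Let g_pi x : g (\pi_(tens N M)%qT x) = fext h x.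
Proof.
apply/eqP; rewrite -subr_eq0 /g -[X in X == _]hB; apply/eqP/h_rel.
have : (repr (\pi_(tens N M)%qT x) == x %[mod tens N M])%qT by rewrite reprK.
by rewrite -Quotient.idealrBE => /asboolP.
Qed.

(** The existence half of the universal property for balanced biadditive maps; [tens_eq] is the
    uniqueness half. *)
Lemma tens_lift : exists f : {additive tens N M -> A},
  forall n m, f (tpure n m) = b n m.
Proof.
have ga : zmod_morphism g.
  by move=> s t; rewrite -[s]reprK -[t]reprK -raddfB !g_pi raddfB.
exists (HB.pack_for {additive tens N M -> A} g
  (GRing.isZmodMorphism.Build (tens N M) A g ga)) => n m /=.
by rewrite [LHS]g_pi fext_fbasis.
Qed.

End Lift.

Lemma tpure0l N M (m : M) : tpure (0 : N) m = 0.
Proof. by apply: (addrI (tpure 0 m)); rewrite -tpureDl !addr0. Qed.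

Lemma tpure0r N M (n : N) : tpure n (0 : M) = 0.
Proof. by apply: (addrI (tpure n 0)); rewrite -tpureDr !addr0. Qed.

Lemma tpureNl N M (n : N) (m : M) : tpure (- n) m = - tpure n m.
Proof. by apply/eqP; rewrite -addr_eq0 -tpureDl addNr tpure0l. Qed.

Lemma tpureNr N M (n : N) (m : M) : tpure n (- m) = - tpure n m.
Proof. by apply/eqP; rewrite -addr_eq0 -tpureDr addNr tpure0r. Qed.

Lemma tpure_suml N M I (r : seq I) (x : I -> N) (m : M) :
  tpure (\sum_(i <- r) x i) m = \sum_(i <- r) tpure (x i) m.
Proof.
elim: r => [|i r IH]; first by rewrite !big_nil tpure0l.
by rewrite !big_cons tpureDl IH.
Qed.

Lemma tpure_sumr N M I (r : seq I) (n : N) (y : I -> M) :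
  tpure n (\sum_(i <- r) y i) = \sum_(i <- r) tpure n (y i).
Proof.
elim: r => [|i r IH]; first by rewrite !big_nil tpure0r.
by rewrite !big_cons tpureDr IH.
Qed.

Lemma tmap_comm (N N1 N2 N' : rmodType R) (M M1 M2 M' : lmodType R)
    (f1 : {linear N -> N1}) (g1 : {linear M -> M1})
    (f1' : {linear N1 -> N'}) (g1' : {linear M1 -> M'})
    (f2 : {linear N -> N2}) (g2 : {linear M -> M2})
    (f2' : {linear N2 -> N'}) (g2' : {linear M2 -> M'}) t :
  (forall x, f1' (f1 x) = f2' (f2 x)) -> (forall x, g1' (g1 x) = g2' (g2 x)) ->
  tmap f1' g1' (tmap f1 g1 t) = tmap f2' g2' (tmap f2 g2 t).
Proof.
move=> fE gE; move: t.
apply: (tens_eq (f := tmap f1' g1' \o tmap f1 g1) (g := tmap f2' g2' \o tmap f2 g2)).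
by move=> n m /=; rewrite !tmap_tpure fE gE.
Qed.

Lemma tmap_swap (N N' : rmodType R) (M M' : lmodType R)
    (f : {linear N -> N'}) (g : {linear M -> M'}) t :
  tmap f (@idfun M') (tmap (@idfun N) g t) = tmap (@idfun N') g (tmap f (@idfun M) t).
Proof. exact: tmap_comm. Qed.

Lemma tmap_id N M (f : {linear N -> N}) (g : {linear M -> M}) t :
  f =1 id -> g =1 id -> tmap f g t = t.
Proof.
move=> fE gE; elim/tens_ind: t => [|n m|s t hs ht]; first exact: raddf0.
- by rewrite tmap_tpure fE gE.
- by rewrite raddfD /= hs ht.
Qed.

Lemma tmap_compl (N N1 N' : rmodType R) M (f : {linear N -> N1})
    (f' : {linear N1 -> N'}) (h : {linear N -> N'}) t :
  (forall x, f' (f x) = h x) ->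
  tmap f' (@idfun M) (tmap f (@idfun M) t) = tmap h (@idfun M) t.
Proof.
move=> fE; rewrite -[in RHS](@tmap_id _ _ (@idfun N) (@idfun M) t) //.
exact: tmap_comm.
Qed.

Lemma tmap_compr N (M M1 M' : lmodType R) (g : {linear M -> M1})
    (g' : {linear M1 -> M'}) (h : {linear M -> M'}) t :
  (forall x, g' (g x) = h x) ->
  tmap (@idfun N) g' (tmap (@idfun N) g t) = tmap (@idfun N) h t.
Proof.
move=> gE; rewrite -[in RHS](@tmap_id _ _ (@idfun N) (@idfun M) t) //.
exact: tmap_comm.
Qed.

Lemma tmap_0l (N N' : rmodType R) (M M' : lmodType R)
    (f : {linear N -> N'}) (g : {linear M -> M'}) t :
  (forall x, f x = 0) -> tmap f g t = 0.
Proof.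
move=> f0; elim/tens_ind: t => [|n m|s t hs ht]; first exact: raddf0.
- by rewrite tmap_tpure f0 tpure0l.
- by rewrite raddfD /= hs ht addr0.
Qed.

Lemma tmap_inj0 (N N' : rmodType R) (M M' : lmodType R)
    (f : {linear N -> N'}) (g : {linear M -> M'}) t :
  injective (tmap f g) -> tmap f g t = 0 -> t = 0.
Proof. exact: ker0_inj. Qed.

Lemma tmap_ker0 (N N' : rmodType R) (M M' : lmodType R)
    (f : {linear N -> N'}) (g : {linear M -> M'}) :
  (forall t, tmap f g t = 0 -> t = 0) -> injective (tmap f g).
Proof. exact: inj_ker0. Qed.

Lemma tmap_0r (N N' : rmodType R) (M M' : lmodType R)
    (f : {linear N -> N'}) (g : {linear M -> M'}) t :
  (forall x, g x = 0) -> tmap f g t = 0.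
Proof.
move=> g0; elim/tens_ind: t => [|n m|s t hs ht]; first exact: raddf0.
- by rewrite tmap_tpure g0 tpure0r.
- by rewrite raddfD /= hs ht addr0.
Qed.

Lemma tmap_Dl (N N' : rmodType R) (M M' : lmodType R)
    (f f1 f2 : {linear N -> N'}) (g : {linear M -> M'}) t :
  (forall x, f x = f1 x + f2 x) -> tmap f g t = tmap f1 g t + tmap f2 g t.
Proof.
move=> fE; elim/tens_ind: t => [|n m|s t hs ht]; first by rewrite !raddf0 addr0.
- by rewrite !tmap_tpure fE tpureDl.
- by rewrite !raddfD /= hs ht addrACA.
Qed.

Lemma tmap_surj (N N' : rmodType R) (M M' : lmodType R)
    (f : {linear N -> N'}) (g : {linear M -> M'}) :
  surj f -> surj g -> surj (tmap f g).
Proof.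
move=> fs gs; elim/tens_ind => [|n m|s t [s' <-] [t' <-]].
- by exists 0; rewrite raddf0.
- have [n' <-] := fs n; have [m' <-] := gs m.
  by exists (tpure n' m'); rewrite tmap_tpure.
- by exists (s' + t'); rewrite raddfD.
Qed.

(** Both factors vary at once and G is any subgroup containing the pure tensors with a factor in a
    kernel. Right exactness in either variable is then an instance, with G an image. *)
Section RightExact.
Variables (N N' : rmodType R) (M M' : lmodType R).
Variables (f : {linear N -> N'}) (g : {linear M -> M'}).
Hypotheses (f_surj : surj f) (g_surj : surj g).
Variable G : {pred tens N M}.
Hypothesis G_zmod : zmod_closed G.
Hypothesis Gl : forall n m, f n = 0 -> tpure n m \in G.
Hypothesis Gr : forall n m, g m = 0 -> tpure n m \in G.

Let subgrp : {pred tens N M} := G.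
HB.instance Definition _ := GRing.isZmodClosed.Build (tens N M) subgrp G_zmod.
Let Q : zmodType := Quotient.quot subgrp.
Let pi (t : tens N M) : Q := \pi_Q%qT t.

Let piB s t : pi (s - t) = pi s - pi t.
Proof. exact: raddfB. Qed.

Let piD s t : pi (s + t) = pi s + pi t.
Proof. exact: raddfD. Qed.

Let pi0 : pi 0 = 0.
Proof. exact: raddf0. Qed.

Let pi_eq0 t : pi t = 0 <-> t \in G.
Proof.
rewrite -pi0; split=> [/eqP|tG].
  by rewrite -Quotient.idealrBE subr0.
by apply/eqP; rewrite -Quotient.idealrBE subr0.
Qed.

Let pi_pure n n' m m' : f n = f n' -> g m = g m' -> pi (tpure n m) = pi (tpure n' m').
Proof.
move=> fn gm; transitivity (pi (tpure n' m)); apply/subr0_eq; rewrite -piB; apply/pi_eq0.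
  by rewrite -tpureNl -tpureDl; apply: Gl; rewrite linearB fn subrr.
by rewrite -tpureNr -tpureDr; apply: Gr; rewrite linearB gm subrr.
Qed.

(* The map tpure (f n) (g m) |-> tpure n m is well defined modulo G. *)
Lemma tmap_kernel t : tmap f g t = 0 -> t \in G.
Proof.
have [s sE] := choice f_surj; have [r rE] := choice g_surj.
have [n n' m|n m m'|n a m|h hE] := @tens_lift N' M' Q (fun n m => pi (tpure (s n) (r m))).
- by rewrite -piD -tpureDl; apply: pi_pure; rewrite ?linearD ?sE.
- by rewrite -piD -tpureDr; apply: pi_pure; rewrite ?linearD ?rE.
- rewrite (pi_pure (n' := (a : R^c) *: s n) (m' := r m)) ?linearZ_LR ?sE //.
  by rewrite tpureZ; apply: pi_pure; rewrite ?linearZ_LR ?rE.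
have hpi u : h (tmap f g u) = pi u.
  elim/tens_ind: u => [|n m|u v hu hv]; first by rewrite !raddf0 pi0.
  - by rewrite tmap_tpure hE; apply: pi_pure; rewrite ?sE ?rE.
  - by rewrite !raddfD /= hu hv piD.
by move=> t0; apply/pi_eq0; rewrite -hpi t0 raddf0.
Qed.

End RightExact.

Lemma tmap_exact_l (K N N' : rmodType R) M (k : {linear K -> N}) (f : {linear N -> N'}) :
  exact_at k f -> surj f -> forall t : tens N M,
  tmap f (@idfun M) t = 0 -> exists s, tmap k (@idfun M) s = t.
Proof.
move=> kf fs t t0; apply/asboolP.
pose G : {pred tens N M} := fun t => `[< exists s, tmap k (@idfun M) s = t >].
apply: (tmap_kernel (G := G) fs _ _ _ _ t0).
- by move=> y; exists y.
- split=> [|_ _ /asboolP[x <-] /asboolP[y <-]]; apply/asboolP.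
    by exists 0; rewrite raddf0.
  by exists (x - y); rewrite raddfB.
- by move=> n m /kf[x <-]; apply/asboolP; exists (tpure x m); rewrite tmap_tpure.
- by move=> n m /= ->; apply/asboolP; exists 0; rewrite raddf0 tpure0r.
Qed.

Lemma tmap_exact_r N (L M M' : lmodType R) (k : {linear L -> M}) (g : {linear M -> M'}) :
  exact_at k g -> surj g -> forall t : tens N M,
  tmap (@idfun N) g t = 0 -> exists s, tmap (@idfun N) k s = t.
Proof.
move=> kg gs t t0; apply/asboolP.
pose G : {pred tens N M} := fun t => `[< exists s, tmap (@idfun N) k s = t >].
apply: (tmap_kernel (G := G) _ gs _ _ _ t0).
- by move=> y; exists y.
- split=> [|_ _ /asboolP[x <-] /asboolP[y <-]]; apply/asboolP.
    by exists 0; rewrite raddf0.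
  by exists (x - y); rewrite raddfB.
- by move=> n m /= ->; apply/asboolP; exists 0; rewrite raddf0 tpure0l.
- by move=> n m /kg[x <-]; apply/asboolP; exists (tpure n x); rewrite tmap_tpure.
Qed.

End TensorProduct.

(** * Flatness of projective modules *)

Section FiniteSupport.
Variables (S : pzRingType) (K : choiceType).

Lemma freemod_sum (s : seq K) (x : freemod S K) : uniq s ->
  (forall k, x k != 0 -> k \in s) ->
  x = \sum_(k <- s) (x k : S) *: fbasis S k.
Proof.
move=> s_uniq xs; rewrite -fextE //.
apply: (@freemod_ext _ _ _ (@idfun (freemod S K)) (fext (fbasis S (K:=K)))) => k /=.
by rewrite fext_fbasis.
Qed.

(** For duplicate-free s, [rv_in s] and [rv_out s] make the free module on s a direct summand of the
    free module on K. *)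
Definition rv_in (s : seq K) : {linear 'rV[S]_(size s) -> freemod S K} :=
  rv_ext (fun i => fbasis S (tnth (in_tuple s) i)).

Definition rv_out (s : seq K) (x : freemod S K) : 'rV[S]_(size s) :=
  \row_i x (tnth (in_tuple s) i).

Lemma rv_out_linear s : linear (@rv_out s).
Proof. by move=> a x y; apply/rowP => i; rewrite !mxE. Qed.

HB.instance Definition _ s :=
  GRing.isLinear.Build S (freemod S K) 'rV[S]_(size s) _ (@rv_out s) (@rv_out_linear s).

Lemma rv_inK s : uniq s -> cancel (@rv_in s) (@rv_out s).
Proof.
move=> s_uniq.
apply: (@lin_rv_eq _ _ _ (@rv_out s \o @rv_in s) (@idfun 'rV[S]_(size s))) => i /=.
rewrite rv_ext_delta; apply/rowP => j; rewrite !mxE eqxx /=.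
have /tuple_uniqP/inj_eq-> : uniq (in_tuple s) by [].
by [].
Qed.

Lemma rv_outK s (x : freemod S K) : uniq s -> (forall k, x k != 0 -> k \in s) ->
  rv_in s (rv_out s x) = x.
Proof.
move=> s_uniq xs; rewrite [RHS](freemod_sum s_uniq xs) (big_tnth _ _ s).
by apply: eq_bigr => i _; rewrite mxE.
Qed.

Lemma rv_in_supp s v k : rv_in s v k != 0 -> k \in s.
Proof.
apply: contraNT => ks; rewrite -[X in X == _]/(fcoord k _) /= /rv_ext linear_sum.
rewrite big1 ?eqxx // => i _; rewrite linearZ_LR /= /fcoord /=.
have /negPf-> : k != tnth (in_tuple s) i.
  by apply: contraNneq ks => ->; apply: mem_tnth.
exact: mulr0.
Qed.

Lemma supp_list n (x : 'I_n -> freemod S K) :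
  exists2 s : seq K, uniq s & forall i k, x i k != 0 -> k \in s.
Proof.
have /choice[s sE] : forall i, exists s : seq K, forall k, x i k != 0 -> k \in s.
  move=> i; have /asboolP/finite_seqP[s sE] := fcoefP (x i); exists s => k xk.
  by move: (xk : [set k | x i k != 0]%classic k); rewrite sE.
exists (undup (flatten [seq s i | i : 'I_n])); first exact: undup_uniq.
move=> i k xk; rewrite mem_undup; apply/flatten_imageP; exists i => //.
exact: sE.
Qed.

End FiniteSupport.

(* A property of projective modules which suffices for flatness. *)
Definition locally_free (S : pzRingType) (N : lmodType S) :=
  forall k (x : 'I_k -> N), exists n (i : {linear 'rV[S]_n -> N})
    (p : {linear N -> 'rV[S]_n}), forall j, i (p (x j)) = x j.

Lemma freemod_finite (S : pzRingType) (K : choiceType) k (x : 'I_k -> freemod S K) :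
  exists n (i : {linear 'rV[S]_n -> freemod S K}) (p : {linear freemod S K -> 'rV[S]_n}),
  cancel i p /\ forall j, i (p (x j)) = x j.
Proof.
have [s s_uniq sP] := supp_list x.
exists (size s), (@rv_in S K s), (@rv_out S K s); split=> [|j]; first exact: rv_inK.
by apply: rv_outK => //; apply: sP.
Qed.

Lemma projective_locally_free (S : pzRingType) (P : lmodType S) :
  projective P -> locally_free P.
Proof.
move=> /projective_retract[s sK] k x.
have [n [i [p [_ ip]]]] := freemod_finite (s \o x).
by exists n, (aug P \o i), (p \o s) => j /=; rewrite ip sK.
Qed.

Section Flatness.
Variable R : pzRingType.
Implicit Types (N : rmodType R) (M : lmodType R).

(** The isomorphism of R^n (x) M with M^n, [c i] being the i-th coordinate; the last clause lets a
    tensor be proved zero coordinatewise. *)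
Lemma tens_rvl n M : exists c : 'I_n -> {additive tens 'rV[R^c]_n M -> M},
  (forall i v m, c i (tpure v m) = (v 0 i : R) *: m) /\
  forall t, t = \sum_i tpure (delta_mx 0 i) (c i t).
Proof.
have /choice[c cE] : forall i : 'I_n, exists c : {additive tens 'rV[R^c]_n M -> M},
    forall v m, c (tpure v m) = (v 0 i : R) *: m.
  move=> i; apply: tens_lift => [v v' m|v m m'|v a m].
  - by rewrite mxE scalerDl.
  - by rewrite scalerDr.
  - by rewrite mxE scalerA.
exists c; split=> //; elim/tens_ind => [|v m|s t hs ht].
- by rewrite big1 // => i _; rewrite raddf0 tpure0r.
- rewrite [in LHS](matrix_sum_delta v) big_ord1 tpure_suml.
  by apply: eq_bigr => i _; rewrite (tpureZ (R:=R)) cE.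
- by rewrite [in LHS]hs [in LHS]ht -big_split; apply: eq_bigr => i _; rewrite raddfD tpureDr.
Qed.

Lemma tens_rvr n N : exists c : 'I_n -> {additive tens N 'rV[R]_n -> N},
  (forall i x v, c i (tpure x v) = (v 0 i : R^c) *: x) /\
  forall t, t = \sum_i tpure (c i t) (delta_mx 0 i).
Proof.
have /choice[c cE] : forall i : 'I_n, exists c : {additive tens N 'rV[R]_n -> N},
    forall x v, c (tpure x v) = (v 0 i : R^c) *: x.
  move=> i; apply: tens_lift => [x x' v|x v v'|x a v].
  - by rewrite scalerDr.
  - by rewrite mxE scalerDl.
  - by rewrite mxE scalerA.
exists c; split=> //; elim/tens_ind => [|x v|s t hs ht].
- by rewrite big1 // => i _; rewrite raddf0 tpure0l.
- rewrite [in LHS](matrix_sum_delta v) big_ord1 tpure_sumr.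
  by apply: eq_bigr => i _; rewrite -tpureZ cE.
- by rewrite [in LHS]hs [in LHS]ht -big_split; apply: eq_bigr => i _; rewrite raddfD tpureDl.
Qed.

(** A tensor involves finitely many elements of N, so it survives a round trip through some R^n (x)
    M = M^n, where injectivity of g applies in each coordinate. *)
Lemma locally_free_flat_right N : locally_free N -> flat_right N.
Proof.
move=> Nfree M M' g g_inj; apply: tmap_ker0 => t t0.
have [k [x [y tE]]] := tens_sum t; have [n [i [p ip]]] := Nfree k x.
have <- : tmap i (@idfun M) (tmap p (@idfun M) t) = t.
  rewrite (tmap_compl (f := p) (f' := i) (h := (i \o p))) // tE raddf_sum.
  by apply: eq_bigr => j _; rewrite /= tmap_tpure /= ip.
set u := tmap p _ t; suff -> : u = 0 by rewrite raddf0.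
have u0 : tmap (@idfun 'rV[R^c]_n) g u = 0.
  by rewrite -tmap_swap t0 raddf0.
have [c [cE cS]] := tens_rvl n M; have [c' [c'E _]] := tens_rvl n M'.
have cc' j : g (c j u) = c' j (tmap (@idfun 'rV[R^c]_n) g u).
  apply: (tens_eq (f := g \o c j) (g := c' j \o tmap (@idfun 'rV[R^c]_n) g)) => v m /=.
  by rewrite tmap_tpure cE c'E linearZ.
rewrite [LHS]cS big1 // => j _.
by rewrite (_ : c j u = 0) ?tpure0r //; apply: (ker0_inj g_inj); rewrite [LHS]cc' u0 raddf0.
Qed.

Lemma locally_free_flat_left M : locally_free M -> flat_left M.
Proof.
move=> Mfree N N' f f_inj; apply: tmap_ker0 => t t0.
have [k [x [y tE]]] := tens_sum t; have [n [i [p ip]]] := Mfree k y.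
have <- : tmap (@idfun N) i (tmap (@idfun N) p t) = t.
  rewrite (tmap_compr (g := p) (g' := i) (h := (i \o p))) // tE raddf_sum.
  by apply: eq_bigr => j _; rewrite /= tmap_tpure /= ip.
set u := tmap _ p t; suff -> : u = 0 by rewrite raddf0.
have u0 : tmap f (@idfun 'rV[R]_n) u = 0.
  by rewrite tmap_swap t0 raddf0.
have [c [cE cS]] := tens_rvr n N; have [c' [c'E _]] := tens_rvr n N'.
have cc' j : f (c j u) = c' j (tmap f (@idfun 'rV[R]_n) u).
  apply: (tens_eq (f := f \o c j) (g := c' j \o tmap f (@idfun 'rV[R]_n))) => v m /=.
  by rewrite tmap_tpure cE c'E linearZ.
rewrite [LHS]cS big1 // => j _.
by rewrite (_ : c j u = 0) ?tpure0l //; apply: (ker0_inj f_inj); rewrite [LHS]cc' u0 raddf0.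
Qed.

Lemma projective_flat_right N : projective N -> flat_right N.
Proof. by move=> /projective_locally_free/locally_free_flat_right. Qed.

Lemma freemod_flat_left (K : choiceType) : flat_left (freemod R K).
Proof. exact/locally_free_flat_left/projective_locally_free/freemod_projective. Qed.

Lemma regular_flat_left : flat_left (R^o : lmodType R).
Proof.
apply: locally_free_flat_left => k x.
pose p := @fext R unit R^o (fun=> 1).
have il : linear (fun a : R^o => (a : R) *: fbasis R tt).
  by move=> a b c; rewrite scalerDl scalerA.
have [n [i [q [_ iq]]]] := freemod_finite (mklin il \o x).
exists n, (p \o i), (q \o mklin il) => j /=.
by rewrite iq /= linearZ_LR /= fext_fbasis; apply: mulr1.
Qed.

Lemma flat_right_sum (N1 N2 : rmodType R) :
  flat_right N1 -> flat_right N2 -> flat_right (N1 * N2)%type.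
Proof.
move=> f1 f2 M M' g g_inj; apply: tmap_ker0 => t t0.
have il1 : linear (fun x : N1 => (x, 0) : N1 * N2).
  by move=> a x y; congr (_, _); rewrite /= scaler0 addr0.
have il2 : linear (fun x : N2 => (0, x) : N1 * N2).
  by move=> a x y; congr (_, _); rewrite /= scaler0 addr0.
pose i1 := mklin il1; pose i2 := mklin il2.
pose p1 : {linear (N1 * N2)%type -> N1} := fst.
pose p2 : {linear (N1 * N2)%type -> N2} := snd.
have <- : tmap i1 (@idfun M) (tmap p1 (@idfun M) t) +
    tmap i2 (@idfun M) (tmap p2 (@idfun M) t) = t.
  rewrite (tmap_compl (f := p1) (f' := i1) (h := (i1 \o p1))) //.
  rewrite (tmap_compl (f := p2) (f' := i2) (h := (i2 \o p2))) //.
  rewrite -(@tmap_Dl _ _ _ _ _ (@idfun (N1 * N2)%type)) ?tmap_id //.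
  by move=> [x y] /=; congr (_, _); rewrite ?addr0 ?add0r.
have -> : tmap p1 (@idfun M) t = 0.
  apply: (tmap_inj0 (f1 _ _ _ g_inj)).
  by rewrite -tmap_swap t0 raddf0.
have -> : tmap p2 (@idfun M) t = 0.
  apply: (tmap_inj0 (f2 _ _ _ g_inj)).
  by rewrite -tmap_swap t0 raddf0.
by rewrite !raddf0 addr0.
Qed.

Lemma flat_right_iso (N N' : rmodType R) (f : {linear N -> N'}) (g : {linear N' -> N}) :
  cancel f g -> flat_right N' -> flat_right N.
Proof.
move=> fK N'flat M M' h h_inj; apply: tmap_ker0 => t t0.
have <- : tmap g (@idfun M) (tmap f (@idfun M) t) = t.
  by rewrite (tmap_compl (f := f) (f' := g) (h := (@idfun N))) ?tmap_id.
have -> : tmap f (@idfun M) t = 0; last by rewrite raddf0.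
apply: (tmap_inj0 (N'flat _ _ _ h_inj)).
by rewrite -tmap_swap t0 raddf0.
Qed.

(* A diagram chase in the tensor product of K -> P -> X with L -> G -> M', where
   G is free over M' with kernel L. *)
Lemma flat_pure (K P X : rmodType R) (k : {linear K -> P}) (q : {linear P -> X}) :
  injective k -> exact_at k q -> surj q -> flat_right X ->
  forall M : lmodType R, injective (tmap k (@idfun M)).
Proof.
move=> k_inj kq qs Xflat M; apply: tmap_ker0 => t t0.
pose l := @kval _ _ _ (aug M).
have qk x : q (k x) = 0 by apply/kq; exists x.
have al x : aug M (l x) = 0 by exact: gkval.
have [t1 t1E] := tmap_surj (f := @idfun K) (g := aug M)
  (fun y => ex_intro _ y erefl) (@aug_surj _ M) t.
have /(tmap_exact_r (@exact_ker _ _ _ (aug M)) (@aug_surj _ M))[s sE] :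
    tmap (@idfun P) (aug M) (tmap k (@idfun _) t1) = 0.
  by rewrite -tmap_swap t1E t0.
have qs0 : tmap q (@idfun _) s = 0.
  apply: (tmap_inj0 (Xflat _ _ l (@kval_inj _ _ _ (aug M)))).
  rewrite -tmap_swap sE (tmap_compl (f := k) (f' := q) (h := (q \o k))) // tmap_0l //.
have [s' s'E] := tmap_exact_l kq qs qs0.
(* The free module over M is flat, so this equality may be checked after applying k. Then t comes
   from s' through [aug M] after [l], which is zero. *)
rewrite -t1E; have <- : tmap (@idfun K) l s' = t1.
  by apply: (freemod_flat_left k_inj); rewrite tmap_swap s'E.
by rewrite (tmap_compr (g := l) (g' := (aug M)) (h := (aug M \o l))) // tmap_0r.
Qed.

End Flatness.

(** * Tor and flat dimension at most one *)

Lemma homology_eq0 (A B C : zmodType) (f : {additive A -> B}) (g : {additive B -> C}) :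
  (forall x : homology f g, x = 0) <-> (forall b, g b = 0 -> exists a, f a = b).
Proof.
have pi0 (z : cycles g) :
    \pi_(homology f g)%qT z = 0 <-> exists a, f a = cval z.
  rewrite -(raddf0 (\pi_(homology f g)%qT)); split=> [/eqP|zb].
    by rewrite -Quotient.idealrBE subr0 => /asboolP.
  by apply/eqP; rewrite -Quotient.idealrBE subr0; apply/asboolP.
split=> [H0 b gb|ex x].
  have zP : b \in in_cycles g by apply/eqP.
  exact: ((pi0 (Cycle zP)).1 (H0 _)).
by rewrite -[x]reprK; apply/pi0/ex/eqP/cvalP.
Qed.

Section TorVanishing.
Variable R : pzRingType.
Implicit Types (N F H : rmodType R) (M : lmodType R).

(** For projective F and surjective g, the kernel of this map is Tor_1(H, M). *)
Definition tor_inj F H (g : {linear F -> H}) M :=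
  injective (tmap (@kval _ _ _ g) (@idfun M)).

(** The differential P_1 -> P_0 factors through the syzygy K. By right exactness the boundaries in
    P_1 (x) M are the kernel of the surjection onto K (x) M, so Tor_1 is the kernel of K (x) M ->
    P_0 (x) M. *)
Lemma tor_vanishesE H M : tor_vanishes H M 1 <-> tor_inj (aug H) M.
Proof.
pose K := syzygy H 1; pose k : {linear K -> freemod R^c H} := @kval _ _ _ (aug H).
pose k2 : {linear syzygy H 2 -> freemod R^c K} := @kval _ _ _ (aug K).
have dE t : tor_diff H M 0 t = tmap k (@idfun M) (tmap (aug K) (@idfun M) t).
  by rewrite (tmap_compl (h := k \o aug K)).
have d'E t : tor_diff H M 1 t = tmap k2 (@idfun M) (tmap (aug (syzygy H 2)) (@idfun M) t).
  by rewrite (tmap_compl (h := k2 \o aug (syzygy H 2))).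
have surjM (N : rmodType R) : surj (tmap (aug N) (@idfun M)).
  by apply: tmap_surj; [exact: aug_surj | move=> y; exists y].
have ad t : tmap (aug K) (@idfun M) (tmap k2 (@idfun M) t) = 0.
  rewrite (tmap_compl (h := aug K \o k2)) // tmap_0l // => x /=.
  exact: gkval.
rewrite /tor_vanishes [X in X <-> _]homology_eq0; split=> [ex|k_inj t].
  apply: tmap_ker0 => t t0; have [u uE] := surjM K t.
  have [|s sE] := ex u; first by rewrite [LHS]dE uE t0.
  by rewrite -uE -sE [X in tmap _ _ X]d'E ad.
rewrite [X in X = _]dE => /(tmap_inj0 k_inj).
move=> /(tmap_exact_l (@exact_ker _ _ _ (aug K)) (@aug_surj _ K))[s <-].
by have [u <-] := surjM _ s; exists u; rewrite [LHS]d'E.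
Qed.

(* The chase compares two presentations F, F' of H through lifts a : F' -> F and
   b : F -> F'; the defect 1 - b a of F' takes its values in the kernel. *)
Lemma tor_inj_indep F F' H M (g : {linear F -> H}) (g' : {linear F' -> H}) :
  projective F -> projective F' -> surj g -> surj g' ->
  tor_inj g M -> tor_inj g' M.
Proof.
move=> Fp F'p gs g's g_inj; apply: tmap_ker0 => t t0.
have [a aE] := F'p _ _ g g' gs; have [b bE] := Fp _ _ g' g g's.
have [a' a'E] : exists a' : {linear kermod g' -> kermod g}, forall x, kval (a' x) = a (kval x).
  by apply: (into_ker (f := a \o @kval _ _ _ g')) => x /=; rewrite aE gkval.
have [b' b'E] : exists b' : {linear kermod g -> kermod g'}, forall x, kval (b' x) = b (kval x).
  by apply: (into_ker (f := b \o @kval _ _ _ g)) => x /=; rewrite bE gkval.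
have dl : linear (fun x => x - b (a x)).
  by move=> c x y; rewrite !linearP /= scalerDr addrACA.
have [d dE] : exists d : {linear F' -> kermod g'}, forall x, kval (d x) = x - b (a x).
  by apply: (into_ker (f := mklin dl)) => x /=; rewrite linearB bE aE subrr.
rewrite -[t](@tmap_id _ _ _ (@idfun _) (@idfun M)) //.
rewrite (@tmap_Dl _ _ _ _ _ _ (d \o @kval _ _ _ g') (b' \o a')) //; last first.
  by move=> x; apply: kval_inj; rewrite linearD /= dE b'E a'E subrK.
rewrite -(tmap_compl (f := @kval _ _ _ g') (f' := d)) // t0 raddf0 add0r.
rewrite -(tmap_compl (f := a') (f' := b')) // (_ : tmap a' _ t = 0) ?raddf0 //.
apply: (tmap_inj0 g_inj).
rewrite (tmap_compl (h := a \o @kval _ _ _ g')) => [|x]; last exact: a'E.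
by rewrite -(tmap_compl (f := @kval _ _ _ g') (f' := a)) // t0 raddf0.
Qed.

Lemma tor_vanishes_projective F H M (g : {linear F -> H}) : projective F -> surj g ->
  tor_vanishes H M 1 <-> tor_inj g M.
Proof.
move=> Fp gs; rewrite tor_vanishesE.
by split; apply: tor_inj_indep => //; (exact: aug_surj || exact: freemod_projective).
Qed.

Lemma flat_left_tor H M : flat_left M -> tor_vanishes H M 1.
Proof. by move=> Mflat; apply/tor_vanishesE/Mflat/kval_inj. Qed.

(* The kernel of F -> H is the kernel of X1 * F -> X0, (x, a) |-> f x + s a, where
   s lifts F -> H to X0. *)
Lemma F1_kernel_flat F H (g : {linear F -> H}) :
  projective F -> surj g -> F1 H -> flat_right (kermod g).
Proof.
move=> Fp gs [X1 [X0 [f [g' [X1f X0f [f_inj fg' g's]]]]]].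
have [s sE] := Fp _ _ g' g g's.
have gf x : g' (f x) = 0 by apply/fg'; exists x.
have ql : linear (fun z : X1 * F => f z.1 + s z.2).
  by move=> c [x a] [y b] /=; rewrite !linearP scalerDr addrACA.
pose q := mklin ql.
have qs : surj q.
  move=> y; have [a ga] := gs (g' y).
  have /fg'[x fx] : g' (y - s a) = 0 by rewrite linearB sE ga subrr.
  by exists (x, a); rewrite /= fx subrK.
have [p pE] : exists p : {linear kermod q -> kermod g}, forall z, kval (p z) = (kval z).2.
  apply: (into_ker (f := snd \o @kval _ _ _ q)) => z /=.
  by rewrite -sE; have := congr1 g' (gkval z); rewrite /= linearD gf add0r linear0.
have [w wE] : exists w : {linear kermod g -> X1}, forall a, f (w a) = - s (kval a).
  have nl : linear (fun a : kermod g => - s (kval a)).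
    by move=> c x y; rewrite !linearP.
  apply: (factor_inj (f := mklin nl) f_inj) => a /=.
  by apply/fg'; rewrite linearN sE gkval oppr0.
have rl : linear (fun a : kermod g => (w a, kval a) : X1 * F).
  by move=> c x y; rewrite !linearP.
have [r rE] : exists r : {linear kermod g -> kermod q}, forall a, kval (r a) = (w a, kval a).
  by apply: (into_ker (f := mklin rl)) => a /=; rewrite wE addNr.
(* Since p after r is the identity, ker g is a retract of ker q. The latter is pure in the flat
   module X1 * F because the quotient X0 is flat. *)
apply: (flat_right_iso (f := r) (g := p)).
  by move=> a; apply: kval_inj; rewrite pE rE.
move=> M M' h h_inj; apply: tmap_ker0 => t t0.
apply: (tmap_inj0 (flat_pure (@kval_inj _ _ _ q) (@exact_ker _ _ _ q) qs X0f (M := M))).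
apply: (tmap_inj0 (flat_right_sum X1f (projective_flat_right Fp) h_inj)).
by rewrite -tmap_swap t0 raddf0.
Qed.

(** The kernel K of F -> H is flat, so K (x) M -> K (x) M' -> F (x) M' is injective; it also factors
    through F (x) M. *)
Lemma F1fp_flat_sub M M' (i : {linear M -> M'}) :
  injective i -> F1fp_flat M' -> F1fp_flat M.
Proof.
move=> i_inj M'f H HF; have := M'f H HF; rewrite !tor_vanishesE => k_inj.
have Kf := F1_kernel_flat (@freemod_projective _ _) (@aug_surj _ H) HF.2.
apply: tmap_ker0 => t t0; apply: (tmap_inj0 (Kf _ _ i i_inj)).
by apply: (tmap_inj0 k_inj); rewrite tmap_swap t0 raddf0.
Qed.

End TorVanishing.

(** * Factoring maps from finitely presented modules *)

Section FactorThrough.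
Variable S : pzRingType.
Implicit Types (H D : lmodType S) (C : lmodType S -> Prop).

(* The maps f with f k = 0 are the maps from the finitely presented module coker k
   to H. *)
Definition fp_factors C H :=
  forall a b (k : {linear 'rV[S]_b -> 'rV[S]_a}) (f : {linear 'rV[S]_a -> H}),
  (forall x, f (k x) = 0) ->
  exists (D : lmodType S) (f' : {linear 'rV[S]_a -> D}) (h : {linear D -> H}),
    [/\ C D, forall x, f' (k x) = 0 & forall x, h (f' x) = f x].

Lemma fp_factors_trans C C' H :
  fp_factors C H -> (forall D, C D -> fp_factors C' D) -> fp_factors C' H.
Proof.
move=> HC CC' a b k f fk0; have [D [f' [h [CD f'k hf]]]] := HC a b k f fk0.
have [D' [f2 [h' [CD' f2k hf2]]]] := CC' D CD a b k f' f'k.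
by exists D', f2, (h \o h'); split=> // x /=; rewrite hf2 hf.
Qed.

(** These modules lie in both P1fp and F1fp and serve as test objects for all of P1. *)
Definition inj_coker D := exists m n (f : {linear 'rV[S]_m -> 'rV[S]_n})
  (g : {linear 'rV[S]_n -> D}), short_exact f g.

Lemma inj_coker_P1fp D : inj_coker D -> P1fp D.
Proof.
move=> [m [n [f [g fg]]]]; split.
  by have [_ fg' gs] := fg; exists m, n, f, g.
by exists 'rV[S]_m, 'rV[S]_n, f, g; split=> //; exact: rv_projective.
Qed.

(* H is a retract of the cokernel of
   freemod X1 -> freemod X0 + freemod X1, z |-> (s0 (f (aug z)), z - s1 (aug z)),
   an injective map that restricts to finitely generated free submodules. *)
Lemma P1_fp_factors H : P1 H -> fp_factors inj_coker H.
Proof.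
move=> [X1 [X0 [f [g [X1p X0p [f_inj fg gs]]]]]] a b k al alk.
have [s0 s0K] := projective_retract X0p; have [s1 s1K] := projective_retract X1p.
pose K := (X0 + X1)%type; pose G := freemod S K.
pose j0 : {linear freemod S X0 -> G} := fext (fun x : X0 => fbasis S (inl x : K)).
pose j1 : {linear freemod S X1 -> G} := fext (fun x : X1 => fbasis S (inr x : K)).
pose r0 : {linear G -> freemod S X0} :=
  fext (fun z : K => if z is inl x then fbasis S x else 0).
pose r1 : {linear G -> freemod S X1} :=
  fext (fun z : K => if z is inr x then fbasis S x else 0).
have r0j0 x : r0 (j0 x) = x.
  by apply: (@freemod_ext _ _ _ (r0 \o j0) (@idfun _)) => z /=; rewrite !fext_fbasis.
have r0j1 x : r0 (j1 x) = 0.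
  by apply: (@freemod_ext _ _ _ (r0 \o j1) \0) => z /=; rewrite !fext_fbasis.
have r1j0 x : r1 (j0 x) = 0.
  by apply: (@freemod_ext _ _ _ (r1 \o j0) \0) => z /=; rewrite !fext_fbasis.
have r1j1 x : r1 (j1 x) = x.
  by apply: (@freemod_ext _ _ _ (r1 \o j1) (@idfun _)) => z /=; rewrite !fext_fbasis.
(* The first component forgets the complement of s1 X1 in the free module on X1; the second records
   exactly this complement, so F is an injection of free modules. *)
pose F : {linear freemod S X1 -> G} :=
  (j0 \o s0 \o f \o aug X1) \+ (j1 \o (@idfun (freemod S X1) \- (s1 \o aug X1))).
have r0F z : r0 (F z) = s0 (f (aug X1 z)) by rewrite /= linearD r0j0 r0j1 addr0.
have F_inj : injective F.
  apply: inj_ker0 => z Fz.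
  have z1 : z = s1 (aug X1 z).
    by have := congr1 r1 Fz; rewrite /= linearD r1j0 r1j1 add0r linear0 => /subr0_eq.
  have s0f : s0 (f (aug X1 z)) = 0.
    by rewrite -r0F Fz linear0.
  have z0 : aug X1 z = 0.
    by apply: (ker0_inj f_inj); rewrite -[LHS]s0K s0f linear0.
  by rewrite z1 z0 linear0.
(* The generators are lifted to X0; the relations then fall into the image of f, and [be] gives
   their preimages in X1. *)
have [a1 a1E] := rv_projective (g := g) al gs.
have [be beE] : exists be : {linear 'rV[S]_b -> X1}, forall x, f (be x) = a1 (k x).
  by apply: (factor_inj (f := a1 \o k) f_inj) => x; apply/fg; rewrite a1E alk.
pose a2 := j0 \o s0 \o a1; pose b2 := s1 \o be.
have Fb2 x : F (b2 x) = a2 (k x) by rewrite /= s1K beE subrr linear0 addr0.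
(* sX supports the lifted relations, sY both the lifted generators and the images under F of the
   basis elements in sX. Hence F restricts to a matrix f' between the free modules on sX and sY. *)
have [sX uX sXP] := supp_list (fun i => b2 (delta_mx 0 i)).
have [sY1 _ sY1P] := supp_list (fun i => a2 (delta_mx 0 i)).
have [sY2 _ sY2P] := supp_list (fun i => F (rv_in S sX (delta_mx 0 i))).
pose sY := undup (sY1 ++ sY2); have uY : uniq sY by exact: undup_uniq.
pose iX := rv_in S sX; pose iY := rv_in S sY.
have iYK : cancel iY (@rv_out S K sY) by exact: rv_inK.
have iY_inj : injective iY by exact: can_inj iYK.
have ib2 x : iX (rv_out sX (b2 x)) = b2 x.
  apply: (@lin_rv_eq _ _ _ (iX \o @rv_out S X1 sX \o b2) b2) => i /=.
  by rewrite rv_outK // => z; apply: sXP.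
pose f' := @rv_out S K sY \o F \o iX; pose a' := @rv_out S K sY \o a2.
have iYf' x : iY (f' x) = F (iX x).
  apply: (@lin_rv_eq _ _ _ (iY \o f') (F \o iX)) => i /=.
  rewrite rv_outK // => z /sY2P zs; rewrite mem_undup mem_cat; apply/orP; right; exact: zs.
have iYa' x : iY (a' x) = a2 x.
  apply: (@lin_rv_eq _ _ _ (iY \o a') a2) => i /=.
  rewrite rv_outK // => z /sY1P zs; rewrite mem_undup mem_cat; apply/orP; left; exact: zs.
have f'_inj : injective f'.
  move=> x y fxy; apply/(can_inj (rv_inK uX))/F_inj.
  by rewrite -/iX -!iYf' fxy.
have [D [p [fp ps]]] := coker_exists f'.
pose ga := g \o aug X0 \o r0.
have gaF z : ga (F z) = 0.
  by rewrite -[LHS]/(g (aug X0 (r0 (F z)))) r0F s0K; apply/fg; exists (aug X1 z).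
have [h hE] : exists h : {linear D -> H}, forall v, h (p v) = ga (iY v).
  apply: (factor_surj (f := ga \o iY) ps) => v /fp[u <-] /=.
  by rewrite iYf'; exact: gaF.
exists D, (p \o a'), h; split=> [|x|x].
- by exists _, _, f', p.
- apply/fp; exists (rv_out sX (b2 x)); apply: iY_inj.
  by rewrite iYf' ib2 Fb2 iYa'.
- by rewrite [LHS]hE iYa' -[LHS]/(g (aug X0 (r0 (j0 (s0 (a1 x)))))) r0j0 s0K a1E.
Qed.

End FactorThrough.

(** * Tor vanishing tested on injective matrices *)

Section MatrixFlatness.
Variable R : pzRingType.
Implicit Types (H D : rmodType R) (M : lmodType R).

(** The finitely many syzygies occurring in a tensor t define a finitely presented module mapping to
    H. Factoring that map through D in C moves the question to Tor_1(D, M), which vanishes. *)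
Lemma fp_factors_tor (C : rmodType R -> Prop) H M :
  fp_factors C H -> rtor C M -> tor_vanishes H M 1.
Proof.
move=> HC CM; apply/tor_vanishesE; apply: tmap_ker0 => t t0.
have [b [x [y tE]]] := tens_sum t.
have [a [i [p [iK ipx]]]] := freemod_finite (fun j => kval (x j)).
pose k : {linear 'rV[R^c]_b -> 'rV[R^c]_a} := rv_ext (fun j => p (kval (x j))).
have kE j : i (k (delta_mx 0 j)) = kval (x j) by rewrite /= rv_ext_delta ipx.
have augk v : aug H (i (k v)) = 0.
  apply: (@lin_rv_eq _ _ _ (aug H \o i \o k) \0) => j.
  by rewrite /= rv_ext_delta ipx gkval.
have [D [f' [h [CD f'k hf']]]] := HC _ _ k (aug H \o i) augk.
have [ph phE] := rv_projective (g := aug D) f' (@aug_surj _ D).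
have [q qE] := freemod_projective (h \o aug D) (@aug_surj _ H).
have [w wE] : exists w : {linear 'rV[R^c]_b -> kermod (aug D)},
    forall v, kval (w v) = ph (k v).
  by apply: (into_ker (f := ph \o k)) => v; rewrite [LHS]phE f'k.
have [q' q'E] : exists q' : {linear kermod (aug D) -> kermod (aug H)},
    forall v, kval (q' v) = q (kval v).
  apply: (into_ker (f := q \o @kval _ _ _ (aug D))) => v.
  by rewrite /= [LHS]qE /= gkval linear0.
(* Both i and q after ph lift the same map to H, so their difference d has values in the syzygy of
   H. *)
have dl : linear (fun v => i v - q (ph v)).
  by move=> c v v'; rewrite !linearP /= scalerDr addrACA.
have [d dE] : exists d : {linear 'rV[R^c]_a -> kermod (aug H)},
    forall v, kval (d v) = i v - q (ph v).
  apply: (into_ker (f := mklin dl)) => v /=.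
  by rewrite linearB [X in _ - X]qE /= phE hf' subrr.
pose u : tens 'rV[R^c]_b M := \sum_j tpure (delta_mx 0 j) (y j).
have ku0 : tmap k (@idfun M) u = 0.
  have -> : tmap k (@idfun M) u =
        tmap p (@idfun M) (tmap (@kval _ _ _ (aug H)) (@idfun M) t).
    rewrite (tmap_compl (h := p \o @kval _ _ _ (aug H))) // tE.
    rewrite [LHS]raddf_sum [RHS]raddf_sum.
    by apply: eq_bigr => j _; rewrite [LHS]tmap_tpure [RHS]tmap_tpure /= rv_ext_delta.
  by rewrite t0 raddf0.
have wu0 : tmap w (@idfun M) u = 0.
  apply: (tmap_inj0 ((tor_vanishesE D M).1 (CM D CD))).
  by rewrite (tmap_compl (h := ph \o k)) // -(tmap_compl (f := k) (f' := ph)) // ku0 raddf0.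
have [c cE] : exists c : {linear 'rV[R^c]_b -> kermod (aug H)},
    forall v, kval (c v) = i (k v).
  exact: (into_ker (f := i \o k)).
have -> : t = tmap c (@idfun M) u.
  rewrite tE [RHS]raddf_sum; apply: eq_bigr => j _; rewrite [RHS]tmap_tpure.
  by congr tpure; apply: kval_inj; rewrite cE kE.
(* The first summand dies because k already kills u, the second because Tor_1(D, M) = 0 makes w kill
   u. *)
rewrite (@tmap_Dl _ _ _ _ _ _ (d \o k) (q' \o w)) => [|v].
  rewrite -(tmap_compl (f := k) (f' := d)) // ku0 raddf0 add0r.
  by rewrite -(tmap_compl (f := w) (f' := q')) // wu0 raddf0.
by apply: kval_inj; rewrite linearD /= dE q'E wE cE subrK.
Qed.

(** The condition says that f (x) M has zero kernel, written under R^m (x) M = M^m. *)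
Definition matrix_flat M :=
  forall m n (f : {linear 'rV[R^c]_m -> 'rV[R^c]_n}), injective f ->
  forall x : 'I_m -> M,
  (forall j, \sum_i (f (delta_mx 0 i) 0 j : R) *: x i = 0) -> forall i, x i = 0.

(** The kernel of R^n -> coker f is a copy of R^m, so Tor_1(coker f, M) is the kernel of M^m -> M^n.
    Arbitrary modules of P1 reduce to such cokernels by [P1_fp_factors]. *)
Lemma P1_flat_matrix M : P1_flat M <-> matrix_flat M.
Proof.
split=> [MP m n f f_inj x fx i|Mf].
  have [D [p [fp ps]]] := coker_exists f.
  have PD : P1 D by apply: (inj_coker_P1fp _).2; exists m, n, f, p.
  have /(tor_vanishes_projective _ (@rv_projective _ n) ps) p_inj := MP D PD.
  have pf v : p (f v) = 0 by apply/fp; exists v.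
  have [w wE] := into_ker pf.
  have [w' w'E] : exists w' : {linear kermod p -> 'rV[R^c]_m}, forall z, f (w' z) = kval z.
    by apply: (factor_inj (f := @kval _ _ _ p) f_inj) => z; apply/fp; rewrite gkval.
  pose u : tens 'rV[R^c]_m M := \sum_j tpure (delta_mx 0 j) (x j).
  have u0 : tmap w (@idfun M) u = 0.
    apply: (tmap_inj0 p_inj); rewrite (tmap_compl (h := f)) // raddf_sum /=.
    have [c [cE cS]] := tens_rvl n M.
    rewrite [LHS]cS big1 // => j _; rewrite (_ : c j _ = 0) ?tpure0r //.
    rewrite raddf_sum -[RHS](fx j); apply: eq_bigr => l _.
    by rewrite tmap_tpure cE.
  have : tmap w' (@idfun M) (tmap w (@idfun M) u) = u.
    rewrite (tmap_compl (h := @idfun _)) ?tmap_id // => v.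
    by apply: f_inj; rewrite w'E wE.
  rewrite u0 raddf0 => /esym u00; have [c [cE _]] := tens_rvl m M.
  have := congr1 (c i) u00; rewrite raddf0 raddf_sum (bigD1 i) //= cE mxE !eqxx scale1r.
  rewrite big1 ?addr0 // => l li; rewrite cE mxE eqxx /= eq_sym (negPf li) scale0r //.
move=> H /P1_fp_factors HP; apply: (fp_factors_tor HP) => D [m [n [f [g [f_inj fg gs]]]]].
apply/(tor_vanishes_projective _ (@rv_projective _ n) gs); apply: tmap_ker0 => t t0.
have gf v : g (f v) = 0 by apply/fg; exists v.
have [w wE] := into_ker gf.
have ws : surj w.
  by move=> z; have /fg[v fv] := gkval z; exists v; apply: kval_inj; rewrite wE.
have [u uE] := tmap_surj (g := @idfun M) ws (fun y => ex_intro _ y erefl) t.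
rewrite -uE in t0 *; rewrite (tmap_compl (h := f)) // in t0.
have [c [cE cS]] := tens_rvl m M; have [c' [c'E _]] := tens_rvl n M.
suff -> : u = 0 by rewrite raddf0.
rewrite (cS u) big1 // => i _; rewrite (Mf _ _ _ f_inj (fun i => c i u)) ?tpure0r // => j.
have fuE : tmap f (@idfun M) u = \sum_l tpure (f (delta_mx 0 l)) (c l u).
  by rewrite [in LHS](cS u) [LHS]raddf_sum; apply: eq_bigr => l _; exact: tmap_tpure.
rewrite fuE in t0; rewrite -[RHS](raddf0 (c' j)) -t0 raddf_sum.
by apply: eq_bigr => l _; rewrite c'E.
Qed.

End MatrixFlatness.

(** * Coherence and finite presentation *)

Section FinitePresentation.
Variable R : pzRingType.
Implicit Types (N H : rmodType R) (M : lmodType R).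

Lemma P1fp_F1fp H : P1fp H -> F1fp H.
Proof.
move=> [Hfp [X1 [X0 [f [g [X1p X0p fg]]]]]]; split=> //.
by exists X1, X0, f, g; split=> //; exact: projective_flat_right.
Qed.

Lemma free_module_rv (S : pzRingType) n : free_module ('rV[S]_n : lmodType S).
Proof.
pose e : {linear 'rV[S]_n -> freemod S 'I_n} := rv_ext (fun i => fbasis S i).
have dl : linear (fun x : freemod S 'I_n => \row_i x i : 'rV[S]_n).
  by move=> a x y; apply/rowP => i; rewrite !mxE.
exists 'I_n, e, (mklin dl) => [v|x].
  apply: (@lin_rv_eq _ _ _ (mklin dl \o e) (@idfun _)) => i /=.
  by rewrite rv_ext_delta; apply/rowP => j; rewrite !mxE eqxx.
apply: (@freemod_ext _ _ _ (e \o mklin dl) (@idfun _)) => i /=.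
rewrite -[RHS](@rv_ext_delta S n _ (fun i => fbasis S i)) /=; congr rv_ext.
by apply/rowP => j; rewrite !mxE eqxx.
Qed.

(* Flatness turns the relations sum_i g(e_i) (f e_l)_i = 0 of N, read as the
   vanishing of sum_i g(e_i) (x) phi(e_i), into g(e_i) = sum_j n_j (l_j)_i with
   l_j in ker phi; hence idfun factors through a free module. *)
Lemma fp_flat_projective N : fin_presented N -> flat_right N -> projective N.
Proof.
move=> [b [a [f [g [fg gs]]]]] Nflat.
(* The transpose of the relation matrix f, as a map of left modules. *)
pose phi : {linear 'rV[R]_a -> 'rV[R]_b} :=
  rv_ext (fun i => \row_l (f (delta_mx 0 l) 0 i : R)).
have phiE v l : phi v 0 l = \sum_i v 0 i * (f (delta_mx 0 l) 0 i : R).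
  by rewrite /= /rv_ext summxE; apply: eq_bigr => i _; rewrite !mxE.
(* I is the coimage of phi: flatness of N handles the injection I -> R^b, right exactness the
   surjection R^a -> I. *)
have [I [p [pk ps]]] := coker_exists (@kval _ _ _ phi).
have [i iE] : exists i : {linear I -> 'rV[R]_b}, forall v, i (p v) = phi v.
  apply: (factor_surj ps) => v /pk[x <-]; exact: gkval.
have i_inj : injective i.
  apply: inj_ker0 => z; have [v <-] := ps z.
  rewrite [X in X = 0 -> _]iE => /(@exact_ker _ _ _ phi)[x <-].
  by apply/pk; exists x.
pose t : tens N 'rV[R]_a := \sum_i tpure (g (delta_mx 0 i)) (delta_mx 0 i).
have phit : tmap (@idfun N) phi t = 0.
  have [c [cE cS]] := tens_rvr b N.
  rewrite [LHS]cS big1 // => l _; rewrite (_ : c l _ = 0) ?tpure0l //.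
  have gf0 : g (f (delta_mx 0 l)) = 0 by apply/fg; exists (delta_mx 0 l).
  rewrite -[RHS]gf0 [RHS]lin_rv_ext [X in c l X]raddf_sum raddf_sum.
  by apply: eq_bigr => j _; rewrite [X in c l X]tmap_tpure cE /= rv_ext_delta mxE.
have /(tmap_exact_r pk ps)[s sE] : tmap (@idfun N) p t = 0.
  by apply: (tmap_inj0 (Nflat _ _ i i_inj)); rewrite (tmap_compr (h := phi)).
have [k [n [l tE]]] := tens_sum s.
have gE j : g (delta_mx 0 j) = \sum_u ((kval (l u)) 0 j : R^c) *: n u.
  have [c [cE _]] := tens_rvr a N; transitivity (c j t).
    rewrite raddf_sum (bigD1 j) //= cE mxE !eqxx scale1r big1 ?addr0 // => u uj.
    by rewrite cE mxE eqxx /= eq_sym (negPf uj) scale0r.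
  rewrite -sE tE [X in c j X]raddf_sum raddf_sum; apply: eq_bigr => u _.
  by rewrite [X in c j X]tmap_tpure cE.
move=> A B h q hs; have [r rE] := choice hs.
pose q1 : {linear 'rV[R^c]_a -> A} :=
  rv_ext (fun j => \sum_u ((kval (l u)) 0 j : R^c) *: r (q (n u))).
have q1f v : q1 (f v) = 0.
  apply: (@lin_rv_eq _ _ _ (q1 \o f) \0) => w /=; rewrite /rv_ext.
  under eq_bigr do rewrite scaler_sumr.
  rewrite exchange_big big1 // => u _ /=.
  under eq_bigr do rewrite scalerA.
  rewrite -scaler_suml -[X in X *: _]/(\sum_j (kval (l u)) 0 j * (f (delta_mx 0 w) 0 j : R)).
  by rewrite -phiE gkval mxE scale0r.
have [q2 q2E] : exists q2 : {linear N -> A}, forall v, q2 (g v) = q1 v.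
  by apply: (factor_surj gs) => v /fg[w <-].
exists q2 => x; have [v <-] := gs x; rewrite q2E.
apply: (@lin_rv_eq _ _ _ (h \o q1) (q \o g)) => j /=.
rewrite rv_ext_delta gE !linear_sum; apply: eq_bigr => u _.
by rewrite !linearZ_LR /= rE.
Qed.

Lemma coherent_two_presented H :
  right_F1fp_coherent R -> F1fp H -> two_presented H.
Proof.
move=> coh HF; have [[b [a [f [g [fg gs]]]]] HF1] := HF.
have Kf := F1_kernel_flat (@rv_projective _ a) gs HF1.
have gf v : g (f v) = 0 by apply/fg; exists v.
have [w wE] := into_ker gf.
have ws : surj w.
  by move=> z; have /fg[v fv] := gkval z; exists v; apply: kval_inj; rewrite wE.
have [n2 [n1 [f1 [g1 [fg1 g1s]]]]] := coh _ _ (@kval _ _ _ g) (free_module_rv _ a)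
  (@kval_inj _ _ _ g) (ex_intro _ b (ex_intro _ w ws)) Kf.
exists n2, n1, a, f1, (@kval _ _ _ g \o g1), g; split=> // y.
  split=> [|/fg1 /= ->]; last exact: linear0.
  by move=> /(ker0_inj (@kval_inj _ _ _ g))/fg1.
split=> [/(@exact_ker _ _ _ g)[z <-]|[z <-]]; last exact: gkval.
by have [v <-] := g1s z; exists v.
Qed.

Lemma two_presented_P1fp H : two_presented H -> F1fp H -> P1fp H.
Proof.
move=> [n2 [n1 [n0 [e [f [g [ef fg gs]]]]]]] HF; split; first exact: HF.1.
have Kf := F1_kernel_flat (@rv_projective _ n0) gs HF.2.
have gf v : g (f v) = 0 by apply/fg; exists v.
have [w wE] := into_ker gf.
exists (kermod g), 'rV[R^c]_n0, (@kval _ _ _ g), g; split; last 1 first.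
- by split=> //; [exact: kval_inj | exact: exact_ker].
- apply: fp_flat_projective Kf; exists n2, n1, e, w; split=> [y|z].
    rewrite -ef -wE; split=> [->|]; first exact: linear0.
    exact: (ker0_inj (@kval_inj _ _ _ g)).
  by have /fg[v fv] := gkval z; exists v; apply: kval_inj; rewrite wE.
- exact: rv_projective.
Qed.

Definition dprod_eval (I : Type) (M : I -> lmodType R) (i : I) (x : dprod M) : M i := x i.

Lemma dprod_eval_linear (I : Type) (M : I -> lmodType R) (i : I) : linear (@dprod_eval I M i).
Proof. by []. Qed.

HB.instance Definition _ (I : Type) (M : I -> lmodType R) (i : I) :=
  GRing.isLinear.Build R (dprod M) (M i) _ (@dprod_eval I M i) (@dprod_eval_linear I M i).

(* The tautological family of the elements of K = ker g, an element of
   (R^K)^m = R^m (x) R^K, dies in N (x) R^K, so it comes from K (x) R^K, which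
   exhibits finitely many generators of K. *)
Lemma regular_powers_coherent :
  (forall I : Type, F1fp_flat (dprod (fun _ : I => (R^o : lmodType R)))) ->
  right_F1fp_coherent R.
Proof.
move=> pow F N i [K [e e_bij]] i_inj [m [g gs]] Nflat.
(* The generators of N involve finitely many basis elements, so N embeds in a finitely generated
   free module, with a cokernel in F1fp. *)
have [s s_uniq sP] := supp_list (fun l => e (i (g (delta_mx 0 l)))).
pose j : {linear N -> 'rV[R^c]_(size s)} := @rv_out R^c K s \o e \o i.
have jK x : rv_in R^c s (j x) = e (i x).
  have [v <-] := gs x.
  apply: (@lin_rv_eq _ _ _ (rv_in R^c s \o j \o g) (e \o i \o g)) => l /=.
  by rewrite rv_outK // => k; exact: sP.
have j_inj : injective j.
  by move=> x y jxy; apply/i_inj/(bij_inj e_bij); rewrite -!jK jxy.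
have [H [p [jp ps]]] := coker_exists j.
have HF : F1fp H.
  split.
    exists m, (size s), (j \o g), p; split=> // y; split=> [/jp[x <-]|[v <-]].
      by have [v <-] := gs x; exists v.
    by apply/jp; exists (g v).
  exists N, 'rV[R^c]_(size s), j, p; split=> //.
  exact/projective_flat_right/rv_projective.
pose K0 : Type := kermod g.
have /(tor_vanishes_projective _ (@rv_projective _ _) ps) p_inj := pow K0 H HF.
pose M := dprod (fun _ : K0 => (R^o : lmodType R)).
pose rho (l : 'I_m) : M := fun k : K0 => (kval (k : kermod g)) 0 l.
pose t0 : tens 'rV[R^c]_m M := \sum_l tpure (delta_mx 0 l) (rho l).
have pj v : p (j v) = 0 by apply/jp; exists v.
have [w wE] := into_ker pj.
have [w' w'E] : exists w' : {linear kermod p -> N}, forall z, j (w' z) = kval z.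
  by apply: (factor_inj (f := @kval _ _ _ p) j_inj) => z; apply/jp; rewrite gkval.
(* At index k the coordinates of this tensor are those of j (g k), and k lies in ker g. *)
have jt0 : tmap (j \o g) (@idfun M) t0 = 0.
  have [c [cE cS]] := tens_rvl (size s) M.
  rewrite [LHS]cS big1 // => l _; rewrite (_ : c l _ = 0) ?tpure0r //.
  have -> : c l (tmap (j \o g) (@idfun M) t0) =
      \sum_u ((j (g (delta_mx 0 u))) 0 l : R) *: rho u.
    rewrite [X in c l X]raddf_sum raddf_sum; apply: eq_bigr => u _.
    by rewrite [X in c l X]tmap_tpure cE.
  apply: functional_extensionality_dep => k.
  transitivity (((0 : 'rV[R^c]_(size s)) 0 l) : R); last by rewrite mxE.
  rewrite -[in RHS](linear0 j) -(gkval (k : kermod g)).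
  rewrite -[LHS]/(dprod_eval k _) linear_sum -[in RHS]/((j \o g) _) lin_rv_ext summxE.
  rewrite (eq_bigr (fun u =>
    (((kval (k : kermod g)) 0 u *: (j \o g) (delta_mx 0 u)) 0 l : R^o))) //.
  by move=> u _; rewrite [RHS]mxE.
have gt0 : tmap g (@idfun M) t0 = 0.
  rewrite -[LHS](@tmap_id _ _ _ (w' \o w) (@idfun M)) //; last first.
    by move=> x /=; apply: j_inj; rewrite w'E wE.
  rewrite -(tmap_compl (f := w) (f' := w')) // [X in tmap w' _ X](_ : _ = 0) ?raddf0 //.
  apply: (tmap_inj0 p_inj).
  by rewrite (tmap_compl (h := j)) // (tmap_compl (h := j \o g)).
have [u uE] := tmap_exact_l (@exact_ker _ _ _ g) gs gt0.
have [b [n [y yE]]] := tens_sum u.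
exists b, m, (rv_ext (fun l => kval (n l))), g; split=> // v.
split=> [/(@exact_ker _ _ _ g)[k <-]|[z <-]]; last first.
  by rewrite /= linear_sum big1 // => l _; rewrite linearZ_LR /= gkval scaler0.
(* In coordinates at index k, t0 is k itself, while its expression through ker g reads sum_z y_z(k)
   n_z. *)
exists (\row_l (y l k : R^c)); apply/rowP => l.
have [c [cE _]] := tens_rvl m M.
have ct0 : c l t0 = rho l.
  rewrite raddf_sum (bigD1 l) //= cE mxE !eqxx scale1r big1 ?addr0 // => z zl.
  by rewrite cE mxE eqxx /= eq_sym (negPf zl) scale0r.
rewrite -[RHS]/(dprod_eval k (rho l)) -ct0 -uE yE [X in c l X]raddf_sum raddf_sum.
rewrite linear_sum /= /rv_ext summxE; apply: eq_bigr => z _.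
by rewrite [X in c l X]tmap_tpure cE !mxE.
Qed.

End FinitePresentation.

(** * Characters and matrix flatness *)

Section CharacterExtension.
Implicit Type A : zmodType.

(** Cyclicity of subgroups of Z, for annihilators of elements and for the multiples of an element
    lying in the domain of a partial character. *)
Lemma int_subgroup (P : int -> Prop) : P 0 -> (forall m n, P m -> P n -> P (m - n)) ->
  (forall n, P n -> n = 0) \/
  exists d : nat, [/\ (0 < d)%N, P d & forall n, P n -> exists k, n = k * d%:Z].
Proof.
move=> P0 PB; have PN n : P n -> P (- n) by move=> Pn; rewrite -sub0r; exact: PB.
have PM n k : P n -> P (k * n).
  move=> Pn; have Pk (j : nat) : P (j%:Z * n).
    elim: j => [|j IH]; first by rewrite mul0r.
    by rewrite intS mulrDl mul1r -[_ * _]opprK; apply: PB => //; exact: PN.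
  case: k => j; first exact: Pk.
  by rewrite NegzE mulNr; apply: PN; exact: Pk.
have [ex|nex] := pselect (exists d : nat, (0 < d)%N && `[< P d >]); last first.
  left=> n Pn; apply/eqP; apply: contra_notT nex => n0; exists (absz n).
  rewrite absz_gt0 n0; apply/asboolP.
  case: n Pn {n0} => j //; rewrite NegzE => /PN; by rewrite opprK abszN.
right; case: (ex_minnP ex) => d /andP[d0 /asboolP Pd] dmin.
exists d; split=> // n Pn; exists (n %/ d)%Z.
have r0 : (n %% d)%Z = 0.
  have Pr : P (n %% d)%Z by rewrite /modz; apply: PB => //; exact: PM.
  have r_ge0 : (0 <= n %% d)%Z by apply: modz_ge0; rewrite eqz_nat -lt0n.
  have r_lt : ((n %% d)%Z < d)%R by apply: ltz_pmod.
  case: (n %% d)%Z Pr r_ge0 r_lt => // r Pr _ rd.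
  apply/eqP; rewrite eqz_nat -leqn0 leqNgt; apply/negP => r0.
  by have := dmin r; rewrite r0 (asboolT Pr) => /(_ isT); rewrite leqNgt -ltz_nat rd.
by rewrite {1}(divz_eq n d) r0 addr0.
Qed.

Definition qz (r : rat) : QmodZ := \pi_QmodZ%qT r.

Lemma qz_eq0 r : qz r = 0 <-> r \is a Num.int.
Proof.
rewrite /qz -(raddf0 (\pi_QmodZ%qT)); split=> [/eqP|rint].
  by rewrite -Quotient.idealrBE subr0.
by apply/eqP; rewrite -Quotient.idealrBE subr0.
Qed.

Lemma qzMz r n : qz (r *~ n) = qz r *~ n.
Proof. exact: (raddfMz (\pi_QmodZ%qT)). Qed.

Lemma qz_divisible (q : QmodZ) (d : nat) : (0 < d)%N -> exists p, p *~ d%:Z = q.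
Proof.
move=> d0; exists (qz (repr q / d%:R)); rewrite -qzMz -mulrzr divfK ?reprK //.
  by rewrite /qz reprK.
by rewrite pnatr_eq0 -lt0n.
Qed.

Section Extension.
Variables (A : zmodType) (G0 : set (A * QmodZ)%type).

(** Graphs of characters defined on subgroups of A; as sets of pairs they can be united along
    chains. *)
Let good (Y : set (A * QmodZ)%type) :=
  [/\ Y (0, 0), forall u v, Y u -> Y v -> Y (u - v) & forall q, Y (0, q) -> q = 0].

Hypothesis G0_good : good G0.

(** The n with n a in the domain form some dZ, and divisibility of Q/Z gives q with d q the value
    prescribed at d a; if only n = 0 occurs, q = 0 will do. *)
Let extend Y a : good Y -> exists Y' q, [/\ good Y', (Y `<=` Y')%classic & Y' (a, q)].
Proof.
move=> [Y0 YB Yf].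
have YN u : Y u -> Y (- u) by move=> Yu; rewrite -sub0r; apply: YB.
have YD u v : Y u -> Y v -> Y (u + v) by move=> Yu /YN Yv; rewrite -[v]opprK; apply: YB.
have YMz u n : Y u -> Y (u *~ n).
  move=> Yu; have Yk (j : nat) : Y (u *+ j).
    by elim: j => [|j IH]; rewrite ?mulr0n // mulrS; apply: YD.
  by case: n => j; [exact: Yk | apply: YN; exact: Yk].
have pMz (u : A * QmodZ) n : u *~ n = (u.1 *~ n, u.2 *~ n).
  rewrite [LHS]surjective_pairing; congr (_, _).
    exact: (raddfMz (fst : {additive A * QmodZ -> A})).
  exact: (raddfMz (snd : {additive A * QmodZ -> QmodZ})).
have [q qP] : exists q, forall n p, Y (a *~ n, p) -> p = q *~ n.
  have [|m n [p Yp] [r Yr]||[d [d0 [p Yp] dP]]] :=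
      @int_subgroup (fun n => exists p, Y (a *~ n, p)).
  - by exists 0; rewrite mulr0z.
  - by exists (p - r); rewrite mulrzBr; exact: (YB _ _ Yp Yr).
  - move=> n0; exists 0 => n p Yp; have n00 : n = 0 by apply: n0; exists p.
    by rewrite mul0rz; apply: Yf; rewrite n00 mulr0z in Yp.
  have [q qd] := qz_divisible p d0.
  exists q => n r Yr; have [k nk] : exists k, n = k * d%:Z by apply: dP; exists r.
  apply/subr0_eq/Yf.
  have -> : (0, r - q *~ n) = (a *~ n, r) - (a *~ d, p) *~ k :> A * QmodZ.
    have -> : a *~ n = a *~ d *~ k by rewrite nk mulrC mulrzA.
    have -> : q *~ n = p *~ k by rewrite nk mulrC mulrzA qd.
    by rewrite pMz; congr (_, _); rewrite /= subrr.
  by apply: YB => //; apply: YMz.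
exists [set u | exists2 v, Y v & exists n, u = v + (a, q) *~ n]%classic, q.
split.
- split.
  + by exists (0, 0) => //; exists 0; rewrite mulr0z addr0.
  + move=> _ _ [u Yu [m ->]] [v Yv [n ->]]; exists (u - v); first exact: YB.
    by exists (m - n); rewrite mulrzBr opprD addrACA.
  + move=> r [[x y] Yxy [n]].
    rewrite pMz => -[x0 ->].
    have /qP-> : Y (a *~ (- n), y).
      by rewrite mulrNz (_ : - (a *~ n) = x) //; apply/esym/eqP; rewrite -addr_eq0 -x0.
    by rewrite mulrNz addNr.
- by move=> u Yu; exists u => //; exists 0; rewrite mulr0z addr0.
- by exists (0, 0) => //; exists 1; rewrite mulr1z add0r.
Qed.

(** Injectivity of Q/Z: a maximal graph is total by [extend]. *)
Lemma char_extension : exists chi : charmod A, forall a q, G0 (a, q) -> chi a = q.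
Proof.
(* Adjoining G0 inside the predicate makes it hold for the union of the empty chain as well. *)
have [|Z [Zg Zmax]] := @Zorn_bigcup _ (fun X => good (G0 `|` X)%classic).
  move=> F FP Ftot; pose U := (G0 `|` \bigcup_(X in F) X)%classic.
  have FU X : F X -> (G0 `|` X `<=` U)%classic.
    by move=> FX u [G0u|Xu]; [left|right; exists X].
  have pair u v : U u -> U v -> exists Y, [/\ good Y, Y u, Y v & (Y `<=` U)%classic].
    move=> [G0u|[X FX Xu]] [G0v|[X' FX' Xv]].
    - by exists G0; split=> // w; left.
    - by exists (G0 `|` X')%classic; split; [exact: FP|left|right|exact: FU].
    - by exists (G0 `|` X)%classic; split; [exact: FP|right|left|exact: FU].
    - have [XX'|X'X] := Ftot _ _ FX FX'.
        by exists (G0 `|` X')%classic; split; [exact: FP|right; exact: XX'|right|exact: FU].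
      by exists (G0 `|` X)%classic; split; [exact: FP|right|right; exact: X'X|exact: FU].
  have [G00 G0B G0f] := G0_good; split; first by left.
    by move=> u v Uu Uv; have [Y [[_ YB _] Yu Yv YU]] := pair u v Uu Uv; exact/YU/YB.
  by move=> q Uq; have [Y [[_ _ Yf] Yq _ _]] := pair _ _ Uq Uq; exact: Yf.
have [_ YB Yf] := Zg.
have Ytot a : exists q, (G0 `|` Z)%classic (a, q).
  have [Y' [q [Y'g YY' Y'a]]] := extend a Zg; exists q; apply: contrapT => nY.
  apply: (Zmax Y').
    split; first by move=> u Zu; apply: YY'; right.
    by move=> Y'Z; apply: nY; right; exact: Y'Z.
  rewrite (_ : (G0 `|` Y')%classic = Y') //; apply/seteqP; split=> [u [G0u|//]|u Y'u].
    by apply: YY'; left.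
  by right.
have [chi chiE] := choice Ytot.
have chi_eq a q : (G0 `|` Z)%classic (a, q) -> chi a = q.
  move=> Yq; apply/subr0_eq/Yf; rewrite -[X in (X, _)](subrr a).
  exact: (YB _ _ (chiE a) Yq).
have chi_char : chi \in @is_char A.
  by apply/asboolP => x y; apply: chi_eq; exact: (YB _ _ (chiE x) (chiE y)).
by exists (Char chi_char) => a q G0q; apply: chi_eq; left.
Qed.

End Extension.
End CharacterExtension.

Section Characters.

HB.instance Definition _ (A : zmodType) (u : charmod A) :=
  GRing.isZmodMorphism.Build A QmodZ (char_fun u) (charB u).

Definition char_eval (A : zmodType) (x : A) (u : charmod A) : QmodZ := u x.

Lemma char_eval_zmod (A : zmodType) (x : A) : zmod_morphism (char_eval x).
Proof. by []. Qed.

HB.instance Definition _ (A : zmodType) (x : A) :=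
  GRing.isZmodMorphism.Build (charmod A) QmodZ (char_eval x) (char_eval_zmod x).

Lemma char_separates (A : zmodType) (x : A) :
  (forall u : charmod A, u x = 0) -> x = 0.
Proof.
move=> ux; apply: contrapT => x0.
have [q [q0 qP]] : exists q : QmodZ, q <> 0 /\ forall n, x *~ n = 0 -> q *~ n = 0.
  have [|m n|xn0|[d [d0 xd dP]]] := @int_subgroup (fun n => x *~ n = 0).
  - exact: mulr0z.
  - by rewrite mulrzBr => -> ->; rewrite subr0.
  (* Here x has infinite order, so any nonzero element of Q/Z is a possible value. *)
  - exists (qz 2^-1); split=> [/qz_eq0|n /xn0->]; last exact: mulr0z.
    by move=> /norm_intr_ge1 => /(_ isT).
  (* Here x has order d, and 1/d is not an integer because x <> 0 forces d > 1. *)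
  exists (qz d%:R^-1); split=> [/qz_eq0|n /dP[k ->]].
    move=> /norm_intr_ge1; rewrite invr_eq0 pnatr_eq0 -lt0n => /(_ d0).
    rewrite ger0_norm ?invr_ge0 ?ler0n // invf_ge1 ?ltr0n // lern1 => d1.
    apply: x0; rewrite -[x]mulr1z -[RHS]xd; congr (_ *~ _).
    by case: d d0 d1 {xd dP} => [|[]].
  rewrite mulrC mulrzA -qzMz (_ : _ *~ d = 1); last first.
    by rewrite -mulrzr mulVf // pnatr_eq0 -lt0n.
  by rewrite (_ : qz 1 = 0) ?mul0rz //; apply/qz_eq0; exact: rpred1.
pose G0 : set (A * QmodZ)%type := [set u | exists n, u = (x *~ n, q *~ n)]%classic.
have [|u uP] := @char_extension A G0.
  split; first by exists 0; rewrite !mulr0z.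
    by move=> _ _ [m ->] [n ->]; exists (m - n); rewrite !mulrzBr.
  by move=> p [n [/esym/qP xn ->]].
by apply: q0; rewrite -(uP x q) ?ux //; exists 1; rewrite !mulr1z.
Qed.

End Characters.

(** * Products, submodules and biduals of matrix-flat modules *)

Section MatrixFlatClosure.
Variable R : pzRingType.
Implicit Type M : lmodType R.

(** Linear equations are preserved by each u i, and vanishing is detected by all of them together.
    Products, inverse limits and descent from the bidual are instances. *)
Lemma matrix_flat_joint M (I : Type) (D : I -> lmodType R)
    (u : forall i, {linear M -> D i}) :
  (forall x, (forall i, u i x = 0) -> x = 0) ->
  (forall i, matrix_flat (D i)) -> matrix_flat M.
Proof.
move=> u_inj Df m n f f_inj x fx l; apply: u_inj => i.
apply: (Df i m n f f_inj (fun l => u i (x l))) => j.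
rewrite -[RHS](linear0 (u i)) -(fx j) linear_sum.
by apply: eq_bigr => k _; rewrite linearZ_LR.
Qed.

Lemma matrix_flat_prod (I : Type) (D : I -> lmodType R) :
  (forall i, matrix_flat (D i)) -> matrix_flat (dprod D).
Proof.
apply: (matrix_flat_joint (u := fun i => @dprod_eval R I D i : {linear dprod D -> D i})).
by move=> x x0; apply: functional_extensionality_dep => i; exact: x0.
Qed.

Lemma bidual_eval_subproof M (x : M) : (fun u : lchar M => u x) \in @is_char (lchar M).
Proof. by apply/asboolP. Qed.

Definition bidual_eval M (x : M) : rchar (lchar M) := Char (bidual_eval_subproof x).

Lemma bidual_eval_linear M : linear (@bidual_eval M).
Proof.
by move=> a x y; apply/val_inj/funext => u /=; rewrite charD.
Qed.

HB.instance Definition _ M := GRing.isLinear.Build R M (rchar (lchar M)) _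
  (@bidual_eval M) (@bidual_eval_linear M).

Lemma bidual_eval_inj M : injective (@bidual_eval M).
Proof.
apply: inj_ker0 => x x0; apply: char_separates => u.
exact: (congr1 (char_eval (u : lchar M)) x0).
Qed.

(* The character phi of the i0-th copy of M in M^m extends along f : M^m -> M^n to
   (psi_j)_j, and then x i0 phi = sum_j (sum_i f_ij x_i) psi_j. *)
Lemma matrix_flat_bidual M : matrix_flat M -> matrix_flat (rchar (lchar M)).
Proof.
move=> Mf m n f f_inj x fx i0; apply/val_inj/funext => phi.
pose F i j : R := f (delta_mx 0 i) 0 j.
pose img (z : 'I_m -> M) : {ffun 'I_n -> M} := [ffun j => \sum_i F i j *: z i].
(* The graph is functional because matrix flatness makes [img] injective. *)
pose G0 : set ({ffun 'I_n -> M} * QmodZ)%type :=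
  [set u | exists z, u = (img z, (phi : charmod M) (z i0))]%classic.
have [|chi chiP] := @char_extension _ G0.
  split.
  - exists (fun=> 0); congr (_, _); last by rewrite raddf0.
    by apply/ffunP => j; rewrite !ffunE big1 // => i _; rewrite scaler0.
  - move=> _ _ [z ->] [z' ->]; exists (fun i => z i - z' i); congr (_, _) => /=.
      apply/ffunP => j; rewrite !ffunE -sumrB; apply: eq_bigr => i _.
      by rewrite scalerBr.
    by rewrite charB.
  - move=> q [z [/ffunP z0 ->]]; rewrite (Mf m n f f_inj z) ?raddf0 // => j.
    by have := z0 j; rewrite !ffunE.
pose del j (y : M) : {ffun 'I_n -> M} := [ffun l => if l == j then y else 0].
have psiP j : (fun y => chi (del j y)) \in @is_char M.
  apply/asboolP => y y'; rewrite -charB; congr (chi _); apply/ffunP => l.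
  by rewrite !ffunE; case: eqP; rewrite ?subr0.
pose psi j : lchar M := Char (psiP j).
have psiE i : \sum_j (F i j : R^c) *: psi j = if i == i0 then phi : lchar M else 0.
  apply/val_inj/funext => y; rewrite -[LHS]/(char_eval y _) raddf_sum /=.
  transitivity ((phi : charmod M) (if i0 == i then y else 0)); last first.
    by rewrite eq_sym; case: eqP => // _; rewrite raddf0.
  rewrite -(chiP (img (fun l => if l == i then y else 0))
    ((phi : charmod M) (if i0 == i then y else 0))); last first.
    by exists (fun l => if l == i then y else 0).
  transitivity (\sum_j chi (del j (F i j *: y))) => //.
  rewrite -raddf_sum; congr (chi _); apply/ffunP => l.
  rewrite sum_ffunE ffunE (bigD1 l) //= ffunE eqxx big1 ?addr0 => [|j jl]; last first.
    by rewrite ffunE eq_sym (negPf jl).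
  rewrite (bigD1 i) //= eqxx big1 ?addr0 // => j ji.
  by rewrite (negPf ji) scaler0.
transitivity (\sum_i (x i : charmod _) (\sum_j (F i j : R^c) *: psi j)).
  rewrite (bigD1 i0) //= psiE eqxx big1 ?addr0 // => i ii.
  by rewrite psiE (negPf ii) raddf0.
under eq_bigr do rewrite raddf_sum.
rewrite exchange_big big1 // => j _.
by have := congr1 (char_eval (psi j)) (fx j); rewrite raddf_sum.
Qed.

Lemma generalized_sum (I : choiceType) : exists s : charmod (I -> QmodZ),
  forall (i : I) (q : QmodZ), s (fun j => if j == i then q else 0) = q.
Proof.
(* Any duplicate-free list containing the support may be used, so two families can be summed over a
   common list; [sum_supp] gives independence of the list. *)
pose G0 : set ((I -> QmodZ) * QmodZ)%type := [set u | exists r : seq I,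
  [/\ uniq r, forall i, u.1 i != 0 -> i \in r & u.2 = \sum_(i <- r) u.1 i]]%classic.
have sum_supp (h : I -> QmodZ) (r t : seq I) : uniq r -> uniq t ->
    (forall i, h i != 0 -> i \in r) -> (forall i, h i != 0 -> i \in t) ->
    \sum_(i <- r) h i = \sum_(i <- t) h i.
  have E (w : seq I) : \sum_(i <- w) h i = \sum_(i <- [seq i <- w | h i != 0]) h i.
    rewrite big_filter (bigID (fun i => h i != 0)) /= [X in _ + X]big1 ?addr0 //.
    by move=> i /negPn/eqP.
  move=> ur ut hr ht; rewrite E [RHS]E; apply: perm_big.
  apply: uniq_perm; rewrite ?filter_uniq // => i; rewrite !mem_filter.
  by case: eqP => //= /eqP hi; rewrite hr // ht.
have [|s sP] := @char_extension _ G0.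
  split.
  - by exists [::]; split=> //= [i|]; rewrite ?eqxx // big_nil.
  - move=> [h p] [h' p'] [r [ur hr /= ->]] [t [ut ht /= ->]].
    pose w := undup (r ++ t); exists w; split=> /= [|i|]; first exact: undup_uniq.
      rewrite mem_undup mem_cat; apply: contraNT; rewrite negb_or => /andP[ir it].
      apply/eqP; rewrite -[LHS]/(h i - h' i).
      have /eqP-> : h i == 0 by apply: contraNT ir; exact: hr.
      have /eqP-> : h' i == 0 by apply: contraNT it; exact: ht.
      exact: subrr.
    rewrite (sum_supp h r w) ?undup_uniq // => [|i /hr ir]; last first.
      by rewrite mem_undup mem_cat ir.
    rewrite (sum_supp h' t w) ?undup_uniq // => [|i /ht it]; last first.
      by rewrite mem_undup mem_cat it orbT.
    by rewrite -sumrB.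
  - by move=> q [r [_ _ /= ->]]; rewrite big1.
exists s => i q; apply: sP; exists [:: i]; split=> //= [j|].
  by rewrite inE; case: ifP; rewrite ?eqxx.
by rewrite big_seq1 eqxx.
Qed.

Lemma bidual_regular_powers :
  (forall M, F1fp_flat M -> F1fp_flat (rchar (lchar M))) ->
  forall I : Type, F1fp_flat (dprod (fun _ : I => (R^o : lmodType R))).
Proof.
move=> bid I; pose K : choiceType := {classic I}.
pose M := freemod R K; pose P := dprod (fun _ : I => (R^o : lmodType R)).
have [s sE] := generalized_sum K.
have tP (r : P) : (fun u : lchar M => s (fun i : K => u ((r i : R) *: fbasis R i)))
    \in @is_char (lchar M).
  by apply/asboolP => u v; rewrite -charB.
pose theta (r : P) : rchar (lchar M) := Char (tP r).
have theta_lin : linear theta.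
  move=> a r r'; apply/val_inj/funext => u.
  apply: etrans (charD s _ _); congr (char_fun s _).
  apply/funext => i.
  transitivity (u (a *: ((r i : R) *: fbasis R (i : K))) +
    u ((r' i : R) *: fbasis R (i : K))) => //.
  by rewrite -charD scalerA -scalerDl.
apply: (F1fp_flat_sub (i := mklin theta_lin)); last first.
  by apply: bid => H _; exact/flat_left_tor/freemod_flat_left.
apply: inj_ker0 => r r0; apply: functional_extensionality_dep => i.
apply: (@char_separates R^o) => u.
(* On u composed with the i-th coordinate, theta r sees a family concentrated at i, and s returns u
   (r i). *)
have uP : (fun x : M => u (fcoord (i : K) x)) \in @is_char M.
  by apply/asboolP => x y; rewrite -charB.
have := congr1 (char_eval (Char uP : lchar M)) r0; rewrite raddf0 => <-.
rewrite -[LHS](sE (i : K)); congr (char_fun s _); apply/funext => j.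
rewrite -[RHS]/(u ((r j : R) * ((i : K) == j)%:R)) eq_sym.
by case: eqP => [<-|_]; rewrite ?mulr1 // mulr0 raddf0.
Qed.

End MatrixFlatClosure.

(** * Direct limits *)

Section DirectLimits.
Variable S : pzRingType.
Implicit Types (H : lmodType S) (C : lmodType S -> Prop).

Lemma directed_bound (d : Order.disp_t) (I : porderType d) n (i : 'I_n -> I) :
  directed_poset I -> exists k, forall l, (i l <= k)%O.
Proof.
move=> [[i0 _] dir]; suff [k kP] : exists k, forall l, l \in enum 'I_n -> (i l <= k)%O.
  by exists k => l; rewrite kP ?mem_enum.
elim: (enum _) => [|l r [k kP]]; first by exists i0.
have [k' [ik' kk']] := dir (i l) k; exists k' => l'; rewrite inE => /orP[/eqP->//|/kP].
by move=> /le_trans; exact.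
Qed.

Section FromLimit.
Variables (d : Order.disp_t) (I : porderType d) (D : direct_system S I).
Variable H : lmodType S.
Variable u : forall i, {linear D i -> H}.
Hypotheses (dir : directed_poset I) (lim : is_direct_limit u).

(** By directedness the images form a submodule. The projection modulo it and the zero map agree on
    every D i, hence are equal by uniqueness. *)
Lemma direct_limit_surj x : exists i y, u i y = x.
Proof.
have [cc uniq_w] := lim.
pose T : {pred H} := fun x => `[< exists i y, u i y = x >].
have Tc : submod_closed T.
  split=> [|a _ _ /asboolP[i [x' <-]] /asboolP[j [y <-]]]; apply/asboolP.
    by have [[i0 _] _] := dir; exists i0, 0; rewrite linear0.
  have [k [ik jk]] := dir.2 i j.
  by exists k, (a *: ds_map D ik x' + ds_map D jk y); rewrite linearP !cc.
have [Q [p [_ pT]]] := quotient_exists Tc.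
have [|w _ w_uniq] := uniq_w Q (fun i => \0); first by [].
apply/asboolP/pT; rewrite (w_uniq p) => [|i y]; last first.
  by apply/pT/asboolP; exists i, y.
by rewrite -(w_uniq \0).
Qed.

(* The test object is the product of the D j modulo the eventually zero families. *)
Lemma direct_limit_zero i (x : D i) :
  u i x = 0 -> exists j (ij : (i <= j)%O), ds_map D ij x = 0.
Proof.
move=> ux; have [cc univ] := lim; pose P := dprod (fun j : I => D j).
pose T : {pred P} := fun z => `[< exists i0, forall j, (i0 <= j)%O -> z j = 0 >].
have Tc : submod_closed T.
  split=> [|a z z' /asboolP[i0 z0] /asboolP[i1 z1]]; apply/asboolP.
    by have [[i0 _] _] := dir; exists i0.
  have [k [k0 k1]] := dir.2 i0 i1; exists k => j kj.
  rewrite -[LHS]/(a *: z j + z' j) z0 ?z1 ?scaler0 ?addr0 //; exact: le_trans kj.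
have [Q [p [_ pT]]] := quotient_exists Tc.
(* The default 0 at indices not above l is invisible modulo eventually zero families. *)
pose fam l (y : D l) : P := fun j =>
  match @idP (l <= j)%O with ReflectT h => ds_map D h y | ReflectF _ => 0 end.
have famE l y j (lj : (l <= j)%O) : fam l y j = ds_map D lj y.
  rewrite /fam; destruct (@idP (l <= j)%O) as [h|h]; last by have := h lj.
  by rewrite (bool_irrelevance h lj).
have fam_lin l : linear (fam l).
  move=> a y z; apply: functional_extensionality_dep => j.
  rewrite -[RHS]/(a *: fam l y j + fam l z j) /fam.
  by destruct (@idP (l <= j)%O); rewrite ?linearP // scaler0 addr0.
have [|w wE _] := univ Q (fun l => p \o mklin (fam_lin l)).
  move=> l l' ll' y /=; apply/subr0_eq; rewrite -linearB; apply/pT/asboolP.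
  exists l' => j l'j; rewrite -[LHS]/(fam l' _ j - fam l y j).
  rewrite (famE _ _ _ l'j) (famE _ _ _ (le_trans ll' l'j)).
  by rewrite (ds_map_comp ll' l'j (le_trans ll' l'j)) subrr.
have := wE i x; rewrite ux linear0 => /esym/pT/asboolP[i0 z0].
have [k [i0k ik]] := dir.2 i0 i; exists k, ik.
by rewrite -(famE i x k ik); exact: z0.
Qed.

End FromLimit.

(** Finitely many generators lift to a common stage, and finitely many relations die at a common
    later one. *)
Lemma dlim_fp_factors C H : dlim C H -> fp_factors C H.
Proof.
move=> [d [I [D [u [dir CD lim]]]]] a b k f fk.
have surj_u := direct_limit_surj dir lim; have [cc _] := lim.
have /choice[y yE] : forall l : 'I_a, exists y : {i & D i},
    u (projT1 y) (projT2 y) = f (delta_mx 0 l).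
  by move=> l; have [i [y yE]] := surj_u (f (delta_mx 0 l)); exists (existT _ i y).
have [i0 i0P] := directed_bound (fun l => projT1 (y l)) dir.
pose f0 : {linear 'rV[S]_a -> D i0} := rv_ext (fun l => ds_map D (i0P l) (projT2 (y l))).
have uf0 v : u i0 (f0 v) = f v.
  apply: (@lin_rv_eq _ _ _ (u i0 \o f0) f) => l /=.
  by rewrite rv_ext_delta cc yE.
have /choice[j jP] : forall l : 'I_b, exists j, exists ij : (i0 <= j)%O,
    ds_map D ij (f0 (k (delta_mx 0 l))) = 0.
  by move=> l; apply: (direct_limit_zero dir lim); rewrite uf0 fk.
have [j0 j0P] := directed_bound j dir; have [m [i0m j0m]] := dir.2 i0 j0.
exists (D m), (ds_map D i0m \o f0), (u m); split=> // x.
  apply: (@lin_rv_eq _ _ _ (ds_map D i0m \o f0 \o k) \0) => l /=.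
  have [ij jl] := jP l; rewrite -(ds_map_comp ij (le_trans (j0P l) j0m) i0m).
  by rewrite [X in ds_map _ _ X]jl linear0.
by rewrite /= cc uf0.
Qed.

Lemma direct_limit_of (d : Order.disp_t) (I : porderType d) (D : direct_system S I) H
    (u : forall i, {linear D i -> H}) :
  directed_poset I -> is_cocone u -> (forall x, exists i y, u i y = x) ->
  (forall i x, u i x = 0 -> exists j (ij : (i <= j)%O), ds_map D ij x = 0) ->
  is_direct_limit u.
Proof.
move=> [_ dir] cc us u0; split=> // X v vc.
have /choice[ix ixE] : forall x, exists iy : {i & D i}, u (projT1 iy) (projT2 iy) = x.
  by move=> x; have [i [y yE]] := us x; exists (existT _ i y).
have uv i x j y : u i x = u j y -> v i x = v j y.
  move=> uxy; have [k [ik jk]] := dir i j.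
  have : u k (ds_map D ik x - ds_map D jk y) = 0 by rewrite linearB !cc uxy subrr.
  move=> /u0[l [kl]]; rewrite linearB => /subr0_eq.
  by move=> /(congr1 (v l)); rewrite !vc.
pose w x := v _ (projT2 (ix x)).
have wu i x : w (u i x) = v i x by apply: uv; rewrite ixE.
have wl : linear w.
  move=> a x y; have [i [x' <-]] := us x; have [j [y' <-]] := us y.
  have [k [ik jk]] := dir i j.
  rewrite -(cc i k ik x') -(cc j k jk y') -linearP !wu linearP; congr (_ + _).
exists (mklin wl) => [i x|w' w'E x]; first exact: wu.
by have [i [y <-]] := us x; rewrite w'E [RHS]wu.
Qed.

End DirectLimits.

(** * Lazard's construction *)

Section FreePresentations.
Variable S : pzRingType.
Implicit Types (V D : lmodType S).

Lemma rv_pair_map V b1 b2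
    (k1 : {linear 'rV[S]_b1 -> V}) (k2 : {linear 'rV[S]_b2 -> V}) :
  exists k : {linear 'rV[S]_(b1 + b2) -> V},
  [/\ forall v, exists w, k w = k1 v, forall v, exists w, k w = k2 v &
      forall w, exists v v', k w = k1 v + k2 v'].
Proof.
have kl : linear (fun w : 'rV[S]_(b1 + b2) => k1 (lsubmx w) + k2 (rsubmx w)).
  by move=> a x y; rewrite !linearP /= scalerDr addrACA.
exists (mklin kl); split=> [v|v|w].
- by exists (row_mx v 0); rewrite /= row_mxKl row_mxKr linear0 addr0.
- by exists (row_mx 0 v); rewrite /= row_mxKl row_mxKr linear0 add0r.
- by exists (lsubmx w), (rsubmx w).
Qed.

(** With u and v comparing the two presentations, ker q is generated by v (im f) and the elements x
    - v (u x): q x = 0 puts u x in im f. *)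
Lemma fp_kernel_fg D n (q : {linear 'rV[S]_n -> D}) : fin_presented D -> surj q ->
  exists b (k : {linear 'rV[S]_b -> 'rV[S]_n}), exact_at k q.
Proof.
move=> [b [a [f [g [fg gs]]]]] qs.
have [u uE] := rv_projective q gs; have [v vE] := rv_projective g qs.
have kl : linear (fun x => x - v (u x)) by move=> c x y; rewrite !linearP scalerDr addrACA.
have [k [k1 k2 kE]] := rv_pair_map (v \o f) (mklin kl).
exists _, k => x; split=> [qx|[w <-]].
  have /fg[y yE] : g (u x) = 0 by rewrite uE.
  have [w wE] := k1 y; have [w' w'E] := k2 x.
  by exists (w + w'); rewrite linearD wE w'E /= yE addrC subrK.
have [y [z ->]] := kE w; rewrite linearD linearB /= !vE uE subrr addr0.
by apply/fg; exists y.
Qed.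

End FreePresentations.

Section Lazard.
Variables (S : pzRingType) (C : lmodType S -> Prop) (H : lmodType S).
Hypothesis C_fp : forall D : lmodType S, C D -> fin_presented D.
Hypothesis HC : fp_factors C H.

(** Every element of H carries countably many labels, so fresh generators over it exist outside any
    finite set. *)
Local Notation K := (H * nat)%type.
Local Notation P := (freemod S K).
Local Notation ins s := (@rv_in S K (enum_fset s)).
Local Notation outs s := (@rv_out S K (enum_fset s)).

Definition lazard_aug : {linear P -> H} := fext (fun z : K => z.1).

Lemma rv_outs_insK s : cancel (ins s) (@outs s).
Proof. exact/rv_inK/fset_uniq. Qed.

Lemma rv_ins_outsK (s t : {fset K}) v :
  (s `<=` t)%fset -> ins t (outs t (ins s v)) = ins s v.
Proof.
move=> /fsubsetP st; apply: rv_outK => [|k /rv_in_supp ks]; first exact: fset_uniq.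
exact: (st k ks).
Qed.

Lemma rv_ins_outs_basis (s : {fset K}) k :
  k \in s -> ins s (outs s (fbasis S k)) = fbasis S k.
Proof.
move=> ks; apply: rv_outK => [|j]; first exact: fset_uniq.
by rewrite /=; case: (j =P k) => [->//|_]; rewrite eqxx.
Qed.

(* The index (s, T) stands for the quotient of the free module on s by T. *)
Definition lazard_presents (s : {fset K}) (T : set P) (D : lmodType S)
    (q : {linear 'rV[S]_(size (enum_fset s)) -> D}) :=
  [/\ C D, surj q, forall v, T (ins s v) <-> q v = 0,
      forall x, T x -> exists v, x = ins s v &
      forall x, T x -> lazard_aug x = 0].

(** D and q are only asserted to exist: an index is the pair (s, T) alone, which makes the order
    antisymmetric. A module is chosen afterwards in [lazard_obj]. *)
Definition lazard_index : choiceType :=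
  {classic {p : {fset K} * set P |
    exists (D : lmodType S) q, @lazard_presents p.1 p.2 D q}}.

Definition lazard_le (i j : lazard_index) : bool :=
  ((sval i).1 `<=` (sval j).1)%fset && `[< ((sval i).2 `<=` (sval j).2)%classic >].

Lemma lazard_le_refl : reflexive lazard_le.
Proof. by move=> i; rewrite /lazard_le fsubset_refl; apply/asboolP. Qed.

Lemma lazard_le_anti : antisymmetric lazard_le.
Proof.
move=> [[s T] sT] [[s' T'] sT'] /andP[].
move=> /andP[/= ss' /asboolP TT'] /andP[/= s's /asboolP T'T].
apply: eq_exist; congr (_, _); last exact/seteqP.
by apply/eqP; rewrite eqEfsubset ss'.
Qed.

Lemma lazard_le_trans : transitive lazard_le.
Proof.
move=> j i k /andP[ij /asboolP IJ] /andP[jk /asboolP JK]; apply/andP; split.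
  exact: fsubset_trans jk.
by apply/asboolP => x /IJ/JK.
Qed.

Definition lazard_poset : porderType ring_display := HB.pack lazard_index
  (Order.Le_isPOrder.Build ring_display lazard_index
    lazard_le_refl lazard_le_anti lazard_le_trans).

Definition lazard_obj (j : lazard_poset) : lmodType S := projT1 (cid (proj2_sig j)).

Definition lazard_quot (j : lazard_poset) :
    {linear 'rV[S]_(size (enum_fset (sval j).1)) -> lazard_obj j} :=
  projT1 (cid (projT2 (cid (proj2_sig j)))).

Lemma lazard_quotP j : lazard_presents (sval j).2 (lazard_quot j).
Proof. exact: (projT2 (cid (projT2 (cid (proj2_sig j))))). Qed.

Lemma lazard_map_exists (i j : lazard_poset) : (i <= j)%O ->
  exists w : {linear lazard_obj i -> lazard_obj j},
  forall v, w (lazard_quot i v) = lazard_quot j (outs _ (ins _ v)).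
Proof.
move=> /andP[ij /asboolP IJ]; have [_ qs qT _ _] := lazard_quotP i.
have [_ _ qT' _ _] := lazard_quotP j.
pose f := lazard_quot j \o @outs (sval j).1 \o ins (sval i).1.
apply: (factor_surj (f := f) qs) => v /qT/IJ Tv.
by apply/qT'; rewrite rv_ins_outsK.
Qed.

Definition lazard_map i j (ij : (i <= j)%O) : {linear lazard_obj i -> lazard_obj j} :=
  projT1 (cid (lazard_map_exists ij)).

Lemma lazard_mapE i j (ij : (i <= j)%O) v :
  lazard_map ij (lazard_quot i v) = lazard_quot j (outs _ (ins _ v)).
Proof. exact: (projT2 (cid (lazard_map_exists ij))). Qed.

Lemma lazard_quot_surj j : surj (lazard_quot j).
Proof. by have [] := lazard_quotP j. Qed.

Lemma lazard_map_id i (ii : (i <= i)%O) x : lazard_map ii x = x.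
Proof. by have [v <-] := lazard_quot_surj x; rewrite lazard_mapE rv_outs_insK. Qed.

Lemma lazard_map_comp i j k (ij : (i <= j)%O) (jk : (j <= k)%O) (ik : (i <= k)%O) x :
  lazard_map jk (lazard_map ij x) = lazard_map ik x.
Proof.
have [v <-] := lazard_quot_surj x; rewrite !lazard_mapE rv_ins_outsK //.
by have /andP[] := ij.
Qed.

Definition lazard_system : direct_system S lazard_poset :=
  DirectSystem lazard_map_id lazard_map_comp.

Lemma lazard_cocone_exists (j : lazard_poset) :
  exists w : {linear lazard_obj j -> H}, forall v, w (lazard_quot j v) = lazard_aug (ins _ v).
Proof.
have [_ qs qT _ Tpi] := lazard_quotP j.
by apply: (factor_surj (f := lazard_aug \o ins (sval j).1) qs) => v /qT/Tpi.
Qed.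

Definition lazard_cocone (j : lazard_poset) : {linear lazard_system j -> H} :=
  projT1 (cid (lazard_cocone_exists j)).

Lemma lazard_coconeE j v : lazard_cocone j (lazard_quot j v) = lazard_aug (ins _ v).
Proof. exact: (projT2 (cid (lazard_cocone_exists j))). Qed.

(** The finitely presented module with generators s and relations k maps to H through some E in C;
    adjoining fresh generators for E turns E into a quotient of a free module on a larger finite
    set. *)
Lemma lazard_index_above (s : {fset K}) b (k : {linear 'rV[S]_b -> P}) :
  (forall x, exists v, k x = ins s v) -> (forall x, lazard_aug (k x) = 0) ->
  exists j : lazard_poset, (s `<=` (sval j).1)%fset /\ forall x, (sval j).2 (k x).
Proof.
move=> ks pik.
have [k' k'E] : exists k' : {linear 'rV[S]_b -> 'rV[S]_(size (enum_fset s))},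
    forall x, ins s (k' x) = k x.
  apply: (factor_inj (can_inj (@rv_outs_insK s))) => x.
  by have [v ->] := ks x; exists v.
have [|E [f' [h [CE f'k hf']]]] := HC (k := k') (f := lazard_aug \o ins s).
  move=> x; rewrite -[LHS]/(lazard_aug (ins s (k' x))) k'E; exact: pik.
have [b' [n [_ [g [_ gs]]]]] := C_fp CE.
(* The second components of the new generators must not occur in s. *)
pose N := (\sum_(z <- enum_fset s) z.2).+1.
have sN z : z \in s -> (z.2 < N)%N.
  by move=> zs; rewrite ltnS (big_rem z) //= leq_addr.
pose y (l : 'I_n) : K := (h (g (delta_mx 0 l)), (N + l)%N).
have y_notin l : y l \notin s.
  by apply/negP => /sN; rewrite /= ltnNge leq_addr.
pose t := (s `|` [fset x in [seq y l | l : 'I_n]])%fset.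
have yt l : y l \in t by rewrite !inE map_f ?orbT // mem_enum.
(* On a new generator the label minus N recovers its number l; the default 0 is not reached on t. *)
pose hq (z : K) : E := if z \in s then f' (outs s (fbasis S z)) else
  if insub (z.2 - N)%N is Some l then g (delta_mx 0 l) else 0.
pose fq : {linear P -> E} := fext hq.
have fq_s v : fq (ins s v) = f' v.
  apply: (@lin_rv_eq _ _ _ (fq \o ins s) f') => i.
  rewrite /= rv_ext_delta fext_fbasis /hq mem_tnth.
  by congr (f' _); rewrite -[RHS](@rv_outs_insK s) /= rv_ext_delta.
have fq_y l : fq (fbasis S (y l)) = g (delta_mx 0 l).
  by rewrite /= fext_fbasis /hq (negPf (y_notin l)) /= addKn valK.
pose q3 := fq \o ins t.
have h_fq v : h (q3 v) = lazard_aug (ins t v).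
  apply: (@lin_rv_eq _ _ _ (h \o q3) (lazard_aug \o ins t)) => i.
  rewrite /= rv_ext_delta !fext_fbasis.
  have := mem_tnth i (in_tuple (enum_fset t)); move: (tnth _ i) => z.
  rewrite !inE => /orP[zs|/mapP[l _ ->]].
    rewrite /hq zs hf' /= -/(ins s) -[X in fext _ X]/(ins s (outs s (fbasis S z))).
    by rewrite rv_ins_outs_basis // fext_fbasis.
  by rewrite -[hq _](fext_fbasis hq (y l)) -[fext _ _]/(fq _) fq_y.
have q3s : surj q3.
  move=> c; have [v <-] := gs c.
  pose Y : {linear 'rV[S]_n -> P} := rv_ext (fun l => fbasis S (y l)).
  exists (outs t (Y v)).
  have -> : q3 (outs t (Y v)) = fq (Y v).
    apply: (@lin_rv_eq _ _ _ (q3 \o @outs t \o Y) (fq \o Y)) => l.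
    rewrite /= rv_ext_delta -[rv_ext _ _]/(ins t (outs t (fbasis S (y l)))).
    by rewrite rv_ins_outs_basis.
  by apply: (@lin_rv_eq _ _ _ (fq \o Y) g) => l; rewrite /= rv_ext_delta -fq_y.
pose T : set P := [set x | exists v, x = ins t v /\ q3 v = 0]%classic.
have st : (s `<=` t)%fset by exact: fsubsetUl.
have gd : exists (D : lmodType S) q, @lazard_presents t T D q.
  exists E, q3; split=> // [v|x [v [-> _]]|x [v [-> q3v]]].
  - by split=> [[w [/(can_inj (@rv_outs_insK t)) -> //]]|q3v]; exists v.
  - by exists v.
  - by rewrite -h_fq q3v linear0.
exists (exist _ (t, T) gd); split=> // x.
exists (outs t (k x)); rewrite -k'E rv_ins_outsK //; split=> //.
rewrite /q3 /= -/(ins t) -[rv_ext _ _]/(ins t _) rv_ins_outsK //.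
by rewrite -[fext _ _]/(fq _) fq_s f'k.
Qed.

(** Nonemptiness, upper bounds, surjectivity onto H and the death of relations all come from
    [lazard_index_above], with suitable generators and relations. *)
Lemma fp_factors_dlim : dlim C H.
Proof.
have Tgen (j : lazard_poset) : exists b (k : {linear 'rV[S]_b -> P}),
    [/\ forall x, exists v, k x = ins (sval j).1 v, forall x, (sval j).2 (k x) &
        forall x, (sval j).2 x -> exists v, k v = x].
  have [CD qs qT Tin _] := lazard_quotP j; have [b [k kq]] := fp_kernel_fg (C_fp CD) qs.
  exists b, (ins (sval j).1 \o k); split=> [x|x|x Tx].
  - by exists (k x).
  - by apply/qT/kq; exists x.
  - have [v xv] := Tin x Tx; rewrite xv in Tx *.
    by have /kq[w <-] := (qT v).1 Tx; exists w.
have Tpi (j : lazard_poset) x : (sval j).2 x -> lazard_aug x = 0.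
  by have [_ _ _ _] := lazard_quotP j; apply.
have dir : directed_poset lazard_poset.
  split.
    have [x|x|j _] := @lazard_index_above fset0 0 \0; last by exists j.
      by exists 0; rewrite linear0.
    by rewrite linear0.
  move=> i j; have [b1 [k1 [k1s k1T Tk1]]] := Tgen i.
  have [b2 [k2 [k2s k2T Tk2]]] := Tgen j; have [k [kk1 kk2 kE]] := rv_pair_map k1 k2.
  have [x|x|l [sl kT]] := @lazard_index_above ((sval i).1 `|` (sval j).1)%fset _ k.
  + have [v [w ->]] := kE x; have [v' ->] := k1s v; have [w' ->] := k2s w.
    exists (outs _ (ins _ v') + outs _ (ins _ w')).
    by rewrite linearD !rv_ins_outsK ?fsubsetUl ?fsubsetUr.
  + have [v [w ->]] := kE x.
    by rewrite linearD (Tpi _ _ (k1T v)) (Tpi _ _ (k2T w)) addr0.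
  exists l; split; apply/andP; split.
  + exact: fsubset_trans (fsubsetUl _ _) sl.
  + by apply/asboolP => x /Tk1[v <-]; have [w <-] := kk1 v; exact: kT.
  + exact: fsubset_trans (fsubsetUr _ _) sl.
  + by apply/asboolP => x /Tk2[v <-]; have [w <-] := kk2 v; exact: kT.
exists ring_display, lazard_poset, lazard_system, lazard_cocone; split=> //.
  by move=> j; have [] := lazard_quotP j.
apply: direct_limit_of => //.
- move=> i j ij x; have [v <-] := lazard_quot_surj x.
  rewrite -[ds_map _ _ _]/(lazard_map ij (lazard_quot i v)) lazard_mapE.
  rewrite !lazard_coconeE rv_ins_outsK //.
  by have /andP[] := ij.
- move=> x; pose z : K := (x, 0%N).
  have [|//|j [zj _]] := @lazard_index_above [fset z]%fset 0 \0.
  + by exists 0; rewrite linear0.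
  + by move=> y; rewrite linear0.
  exists j, (lazard_quot j (outs _ (fbasis S z))); rewrite lazard_coconeE rv_ins_outs_basis.
    by rewrite /= fext_fbasis.
  by apply: (fsubsetP zj); rewrite inE.
- move=> i x; have [v <-] := lazard_quot_surj x; rewrite lazard_coconeE => piv.
  have [b [k [ks kT Tk]]] := Tgen i.
  (* The element to be killed is imposed as one further relation. *)
  pose kv : {linear 'rV[S]_1 -> P} := rv_ext (fun=> ins (sval i).1 v).
  have v1 w : kv w = ins (sval i).1 (w 0 0 *: v).
    by rewrite linearZ_LR /= /rv_ext big_ord1.
  have [k' [kk1 kk2 kE]] := rv_pair_map k kv.
  have [y|y|j [sj kj]] := @lazard_index_above (sval i).1 _ k'.
  + have [a [c ->]] := kE y; have [a' ->] := ks a.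
    by exists (a' + c 0 0 *: v); rewrite v1 linearD.
  + have [a [c ->]] := kE y.
    by rewrite linearD v1 (Tpi _ _ (kT a)) add0r !linearZ_LR piv scaler0.
  have ij : (i <= j)%O.
    apply/andP; split=> //; apply/asboolP => y /Tk[a <-].
    by have [c <-] := kk1 a; exact: kj.
  exists j, ij; rewrite -[ds_map _ _ _]/(lazard_map ij (lazard_quot i v)) lazard_mapE.
  have [_ _ qT _ _] := lazard_quotP j; apply/qT; rewrite rv_ins_outsK //.
  by have [c] := kk2 (delta_mx 0 0); rewrite v1 mxE !eqxx scale1r => <-.
Qed.

End Lazard.

(** * The equivalences *)

Section Equivalences.
Variable R : pzRingType.
Implicit Types (H : rmodType R) (M : lmodType R).

Definition regular_powers_flat :=
  forall I : Type, F1fp_flat (dprod (fun _ : I => (R^o : lmodType R))).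

(** The half of (10) that depends on R; [F1fp_flat_P1_flat] is the other half. *)
Definition P1_flat_F1fp_flat := forall M, P1_flat M -> F1fp_flat M.

Lemma rtor_sub (C C' : rmodType R -> Prop) M :
  (forall H, C H -> fp_factors C' H) -> rtor C' M -> rtor C M.
Proof. by move=> CC' MC' H /CC' HC'; exact: fp_factors_tor MC'. Qed.

(** The usual identity of a Galois connection; it recovers the flatness classes from the hats in
    (12). *)
Lemma rtor_hat (C : rmodType R -> Prop) M : rtor (hat C) M <-> rtor C M.
Proof.
by split=> [MC H CH|MC H]; [apply: MC => M' M'C; exact: M'C|apply].
Qed.

Lemma fp_factors_refl (S : pzRingType) (C : lmodType S -> Prop) (D : lmodType S) :
  C D -> fp_factors C D.
Proof. by move=> CD a b k f fk; exists D, f, idfun. Qed.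

Lemma inj_coker_F1fp H : inj_coker H -> F1fp H.
Proof. by move=> /inj_coker_P1fp/P1fp_F1fp. Qed.

(** Maps from finitely presented modules to a module of P1 factor through cokernels of injective
    matrices, which belong to F1fp. *)
Lemma F1fp_flat_P1_flat M : F1fp_flat M -> P1_flat M.
Proof.
apply: rtor_sub => H /P1_fp_factors HP; apply: fp_factors_trans HP _ => D.
by move=> /inj_coker_F1fp; exact: fp_factors_refl.
Qed.

Lemma flat_left_F1fp_flat M : flat_left M -> F1fp_flat M.
Proof. by move=> Mflat H _; exact: flat_left_tor. Qed.

Lemma F1fp_flat_matrix M : P1_flat_F1fp_flat -> F1fp_flat M <-> matrix_flat M.
Proof.
move=> PF; rewrite -P1_flat_matrix.
by split=> [/F1fp_flat_P1_flat|/PF].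
Qed.

Lemma coherent_F1fp_P1fp :
  right_F1fp_coherent R -> forall H, F1fp H <-> P1fp H.
Proof.
move=> coh H; split=> [HF|]; last exact: P1fp_F1fp.
by apply: two_presented_P1fp => //; exact: coherent_two_presented.
Qed.

Lemma F1fp_P1fp_flat : (forall H, F1fp H <-> P1fp H) -> P1_flat_F1fp_flat.
Proof. by move=> FP M MP H /FP[_]; exact: MP. Qed.

Lemma regular_powers_P1_flat : regular_powers_flat -> P1_flat_F1fp_flat.
Proof.
by move=> /regular_powers_coherent/coherent_F1fp_P1fp; exact: F1fp_P1fp_flat.
Qed.

Lemma P1_flat_regular_powers : P1_flat_F1fp_flat -> regular_powers_flat.
Proof.
move=> PF I; apply/F1fp_flat_matrix => //; apply: matrix_flat_prod => _.
by apply/P1_flat_matrix => H _; exact/flat_left_tor/regular_flat_left.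
Qed.

(** The index set is ordered by equality, so transition maps are transports along i = j and every
    family is compatible. *)
Lemma prod_inverse_limit (I : Type) (M : I -> lmodType R) :
  exists (d : Order.disp_t) (J : porderType d) (D : inverse_system R J)
    (u : forall j, {linear dprod M -> D j}),
    is_inverse_limit u /\ forall P : lmodType R -> Prop,
      (forall i, P (M i)) -> forall j, P (D j).
Proof.
pose K : choiceType := {classic I}.
pose le (i j : K) := i == j.
have le_refl : reflexive le by move=> i; exact: eqxx.
have le_anti : antisymmetric le by move=> i j /andP[/eqP].
have le_trans : transitive le by move=> j i k /eqP-> /eqP->; exact: eqxx.
pose J : porderType ring_display := HB.pack K
  (Order.Le_isPOrder.Build ring_display K le_refl le_anti le_trans).
pose trans (i j : J) (e : i = j) : {linear M j -> M i} :=
  match e in _ = j return {linear M j -> M i} with erefl => @idfun (M i) end.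
have eJ (i j : J) : (i <= j)%O -> i = j by move/eqP.
have trans_id i (e : i = i) x : trans i i e x = x.
  by rewrite (eq_irrelevance e erefl).
have trans_comp i j k (e : i = j) (e' : j = k) (e'' : i = k) x :
    trans i j e (trans j k e' x) = trans i k e'' x.
  by case: k / e' e'' x; case: j / e => e x; rewrite !trans_id.
pose D : inverse_system R J := @InverseSystem R _ J M (fun i j ij => trans i j (eJ i j ij))
  (fun i ii => trans_id i (eJ i i ii))
  (fun i j k ij jk ik => trans_comp i j k (eJ i j ij) (eJ j k jk) (eJ i k ik)).
exists ring_display, J, D, (fun i => dprod_eval (i : I)); split; last by move=> P PM j; exact: PM.
split=> [i j ij x|X v _].
  by rewrite /=; move: (eJ i j ij) => e; clear ij; case: j / e.
have wl : linear (fun x => (fun i => v i x) : dprod M).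
  by move=> a x y; apply: functional_extensionality_dep => i; rewrite linearP.
exists (mklin wl) => // w wE x; apply: functional_extensionality_dep => i.
exact: wE.
Qed.

(** The map R -> L with 1 |-> x and the zero map have the same projections, so uniqueness identifies
    them. *)
Lemma inverse_limit_joint_inj (d : Order.disp_t) (I : porderType d)
    (D : inverse_system R I) (L : lmodType R) (u : forall i, {linear L -> D i}) :
  is_inverse_limit u -> forall x, (forall i, u i x = 0) -> x = 0.
Proof.
move=> [cc univ] x ux.
have fl : linear (fun a : R^o => (a : R) *: x) by move=> a b c; rewrite scalerDl scalerA.
have [|w _ w_uniq] := univ R^o (fun i => \0).
  by move=> i j ij y; rewrite linear0.
transitivity (mklin fl 1); first by rewrite /= scale1r.
rewrite (w_uniq (mklin fl)) => [|i a]; last by rewrite /= linearZ_LR ux scaler0.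
by rewrite -(w_uniq \0) // => i a; rewrite /= linear0.
Qed.

End Equivalences.

Theorem theorem3p6 (R : pzRingType) :
  [<-> (* (1) *) right_F1fp_coherent R;
       (* (2) *) forall (I : Type) (M : I -> lmodType R),
                  (forall i, F1fp_flat (M i)) -> F1fp_flat (dprod M);
       (* (3) *) forall (I : Type) (M : I -> lmodType R),
                  (forall i, flat_left (M i)) -> F1fp_flat (dprod M);
       (* (4) *) forall I : Type, F1fp_flat (dprod (fun _ : I => (R^o : lmodType R)));
       (* (5) *) forall (d : Order.disp_t) (I : porderType d)
                  (D : inverse_system R I) (L : lmodType R)
                  (u : forall i, {linear L -> D i}),
                  (forall i, F1fp_flat (D i)) -> is_inverse_limit u ->
                  F1fp_flat L;
       (* (6) *) forall H : rmodType R, F1fp H -> two_presented H;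
       (* (7) *) forall H : rmodType R, F1fp H <-> P1fp H;
       (* (8) *) forall M : lmodType R,
                  F1fp_flat M <-> F1fp_flat (rchar (lchar M));
       (* (9) *) forall M : lmodType R, torsionless M -> F1fp_flat M;
       (* (10) *) forall M : lmodType R, F1fp_flat M <-> P1_flat M;
       (* (11) *) forall H : rmodType R, dlim (@F1fp R) H <-> dlim (@P1 R^c) H;
       (* (12) *) forall H : rmodType R, hat (@P1 R^c) H <-> hat (@F1fp R) H].
Proof.
tfae.
- move=> /coherent_F1fp_P1fp/F1fp_P1fp_flat PF I M MF.
  apply/F1fp_flat_matrix => //; apply: matrix_flat_prod => i.
  exact/F1fp_flat_matrix.
- by move=> prod I M Mflat; apply: prod => i; exact: flat_left_F1fp_flat.
- by move=> prod I; apply: prod => _; exact: regular_flat_left.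
- move=> /regular_powers_P1_flat PF d I D L u DF lim.
  apply/F1fp_flat_matrix => //; apply: (matrix_flat_joint (inverse_limit_joint_inj lim)).
  by move=> i; exact/F1fp_flat_matrix.
- move=> lim H HF; apply: coherent_two_presented HF; apply: regular_powers_coherent => I.
  have [d [J [D [u [Dlim DM]]]]] := prod_inverse_limit (fun _ : I => (R^o : lmodType R)).
  apply: (lim d J D _ u _ Dlim); apply: DM => _.
  exact/flat_left_F1fp_flat/regular_flat_left.
- move=> two H; split=> [HF|]; last exact: P1fp_F1fp.
  exact: two_presented_P1fp (two H HF) HF.
- move=> /F1fp_P1fp_flat PF M; rewrite !F1fp_flat_matrix //.
  split=> [|Mf]; first exact: matrix_flat_bidual.
  (* Evaluation embeds M in its bidual, which is a jointly injective family with one member. *)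
  apply: (matrix_flat_joint (I := unit) (D := fun=> rchar (lchar M))
    (u := fun=> @bidual_eval R M)) => // x /(_ tt).
  exact/ker0_inj/bidual_eval_inj.
- move=> bid M [I [f f_inj]]; apply: (F1fp_flat_sub f_inj).
  by apply: bidual_regular_powers => M' /bid.
- move=> tors M; split; first exact: F1fp_flat_P1_flat.
  by apply: regular_powers_P1_flat => I; apply: tors; exists I, idfun.
- move=> FP; have PF : P1_flat_F1fp_flat R by move=> M /FP.
  have FPfp := coherent_F1fp_P1fp (regular_powers_coherent (P1_flat_regular_powers PF)).
  move=> H; split=> [[d [I [D [u [dir DF lim]]]]]|].
    by exists d, I, D, u; split=> // i; have /FPfp[] := DF i.
  (* Maps into a limit of P1 factor through P1 and then through cokernels of injective matrices, so
     the limit can be rebuilt from F1fp. *)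
  move=> /dlim_fp_factors HP; apply: fp_factors_dlim => [D []//|].
  apply: fp_factors_trans HP _ => D /P1_fp_factors DP.
  by apply: fp_factors_trans DP _ => E /inj_coker_F1fp; exact: fp_factors_refl.
- move=> lims; have PF (M : lmodType R) : P1_flat M <-> F1fp_flat M.
    split; last exact: F1fp_flat_P1_flat.
    (* H lies in the limit closure of F1fp, hence by (11) in that of P1; maps to H thus factor
       through P1, and Tor vanishing carries over to H. *)
    apply: (@rtor_sub R (@F1fp R) (@P1 R^c)) => H HF.
    apply: dlim_fp_factors; apply/lims.
    apply: fp_factors_dlim => [D []//|]; exact: fp_factors_refl.
  by move=> H; split=> HH M /PF; exact: HH.
- move=> hats; apply/regular_powers_coherent/P1_flat_regular_powers => M.
  move=> /rtor_hat MP; apply/rtor_hat => H /hats; exact: MP.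
Qed.
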